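(* Let $M$ be a von Neumann algebra and let $p,q$ be projections in $M$. Then the following are equivalent: (i) All decomposable linear transformations from $qMp$ to $M$ are bounded. (ii) If $z$ is a central projection of $M$ such that $zpMp$ is finite dimensional, then $zqMp$ is finite dimensional.
   Context: For an element $x$ of a von Neumann algebra $M$, $\mathrm{in}\,x$ denotes the right support projection of $x$, i.e. the support projection of $x^*x$. If $X$ is a linear subspace of $M$ and $T:X\to M$ is a linear transformation (not assumed bounded), $T$ is called decomposable if $\mathrm{in}\,(Tx)\le \mathrm{in}\,x$ for all $x\in X$. Bounded means bounded with respect to the operator norm. *)

(* Defs.v *)
From HB Require Import structures.
From mathcomp Require Import all_boot all_order all_algebra.
From mathcomp Require Import complex.
From mathcomp Require Import all_classical all_reals topology normedtype.

Set Implicit Arguments.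
Unset Strict Implicit.
Unset Printing Implicit Defensive.

Import Order.TTheory GRing.Theory Num.Theory.
Import numFieldNormedType.Exports.

Local Open Scope classical_set_scope.
Local Open Scope ring_scope.
Local Open Scope complex_scope.

(* Complex Hilbert spaces. The norm of a normed module over [R[i]] takes its
   values in [R[i]]. By the convention of [{dot _ for _}], the inner product is
   linear in the first argument and conjugate-linear in the second. *)
Record hilbertType (R : realType) := HilbertType {
  hilbert_space :> completeNormedModType R[i];
  inner : {dot hilbert_space for Num.conj};
  innerE : forall u : hilbert_space, inner u u = `|u| ^+ 2
}.

Section Operators.
Variables (R : realType) (H : hilbertType R).

(* Operators are plain functions [H -> H], so that linear combinations are
   those of the function space and products are compositions. *)
Implicit Types (A B a b e x : H -> H) (M X S : set (H -> H)).

Definition bounded_operator A : Prop :=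
  linear A /\ exists C : R[i], forall u, `|A u| <= C * `|u|.

Definition opnorm A : R :=
  sup [set complex.Re `|A u| | u in [set u : H | `|u| <= 1]].

(* The condition determines [B]; it is satisfiable whenever [A] is a bounded
   operator, and the default value 0 is irrelevant in that case. *)
Definition adjoint A : H -> H :=
  xget 0 [set B | forall u v, inner H (A u) v = inner H u (B v)].

(* The order of [R[i]] makes [0 <= z] mean that [z] is real and nonnegative, so
   this says that [B - A] is positive. *)
Definition op_le A B : Prop :=
  forall u, 0 <= inner H (B u - A u) u.

Definition commutant S : set (H -> H) :=
  [set B | bounded_operator B /\ forall A, S A -> A \o B = B \o A].

(* Unitality and closure under linear combinations and products follow from the
   last clause. *)
Definition von_neumann_algebra M : Prop :=
  [/\ forall x, M x -> bounded_operator x,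
      forall x, M x -> M (adjoint x)
    & commutant (commutant M) = M].

Definition projection_in M e : Prop :=
  [/\ M e, adjoint e = e & e \o e = e].

Definition central_projection_in M e : Prop :=
  projection_in M e /\ forall x, M x -> e \o x = x \o e.

(* The support projection of a self-adjoint element [x] of [M]: the least
   projection [e] of [M] such that [x e = x]. It always exists when [M] is a
   von Neumann algebra. *)
Definition is_support M x e : Prop :=
  [/\ projection_in M e, x \o e = x
    & forall f, projection_in M f -> x \o f = x -> op_le e f].

Definition support M x : H -> H := xget 0 [set e | is_support M x e].

Definition right_support M x : H -> H := support M (adjoint x \o x).

Definition compression a M b : set (H -> H) :=
  [set a \o x \o b | x in M].

(* [S] is meant to be a linear subspace. *)
Definition finite_dimensional S : Prop :=
  exists (n : nat) (b : 'I_n -> H -> H),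
    (forall i, S (b i)) /\
    forall x, S x -> exists c : 'I_n -> R[i], x = \sum_i c i *: b i.

(* Linear transformations [X -> M] are given by functions on all of [H -> H],
   whose values outside of [X] play no role. *)
Definition linear_transformation X M (T : (H -> H) -> H -> H) : Prop :=
  (forall x, X x -> M (T x)) /\
  forall (c : R[i]) x y, X x -> X y -> T (c *: x + y) = c *: T x + T y.

Definition decomposable X M (T : (H -> H) -> H -> H) : Prop :=
  forall x, X x -> op_le (right_support M (T x)) (right_support M x).

Definition bounded_transformation X (T : (H -> H) -> H -> H) : Prop :=
  exists C : R, forall x, X x -> opnorm (T x) <= C * opnorm x.

End Operators.

(* Main.v *)
(* A linear [T] is decomposable iff [x u = 0] implies [T x u = 0], hence
   [T (x f) = T x f] for every projection [f <= p] of [M].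

   Suppose (ii) and that [T] is unbounded. If there are orthogonal projections
   [f_n <= p] and [x_n = x_n f_n] with [|x_n| <= 2^-n] and [|T x_n| > n], then
   [T] cannot be defined at [x = sum x_n], as [T x f_n = T x_n]. To find them,
   split off from a projection [e] on which [T] is unbounded a piece [f] with a
   large [T (x f)], leaving [T] unbounded on [e - f]: a spectral projection [f]
   of [|T x|] has large [T (x g)] for every nonzero [g <= f], so this fails only
   if [T] is unbounded on a minimal projection [f]. Then, for the central
   support [z] of [f], either [z p M p] is finite dimensional, and (ii) makes
   [q M f] finite dimensional; or there are infinitely many orthogonal [f_n <= p]
   equivalent to [f], and [T] is unbounded on each of them.

   Conversely, if [z p M p] is finite dimensional and [z q M p] is not, then
   [q M e] is infinite dimensional for some minimal [e <= z p]. A discontinuous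
   linear functional [phi] on [q M e] and an orthonormal basis [v_j] of the
   finite dimensional [p M e] give the unbounded right module map
   [T x = sum_j phi (x v_j) v_j^*], which is decomposable. *)

Require Import Defs.
From mathcomp Require Import all_boot all_order all_algebra.
From mathcomp Require Import complex ring lra.
From mathcomp Require Import all_classical all_reals topology normedtype.

Set Implicit Arguments.
Unset Strict Implicit.
Unset Printing Implicit Defensive.

Import Order.TTheory GRing.Theory Num.Theory.
Import numFieldNormedType.Exports.

Local Open Scope classical_set_scope.
Local Open Scope ring_scope.
Local Open Scope complex_scope.

(** * Real inner product, completeness and orthogonal projections *)

(** Projections are compared through their kernels: [e <= f] means that [f u = 0] implies [e u = 0].
    This turns decomposability into a condition on single vectors, and right supports then disappear
    from the argument. Apart from algebraic operations, elements of [M] are obtained in two ways,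
    both justified by the bicommutant condition: as projections attached to common kernels, and as
    uniform limits. They replace the spectral theorem. The absolute value of a self-adjoint [c] is a
    uniform limit of an iteration, and the kernel of [|c| + c] separates the positive part of [c]
    from the negative one; every spectral projection in the proof is of this kind. Type and
    dimension theory is replaced by Gram-Schmidt over a minimal projection [f]: for [a], [b] in
    [r M f] the product [a^* b] is a scalar multiple of [f], so [r M f] behaves like an inner
    product space, and either it has a finite orthonormal basis or it contains an infinite
    orthonormal sequence. Each use of finite dimensionality, in both directions, goes through this
    dichotomy. *)

Section Hilbert.
Variables (R : realType) (H : hilbertType R).
Implicit Types (u v w : H) (t : R) (c : R[i]).

Definition nrm u : R := complex.Re `|u|.
Definition rip u v : R := complex.Re (inner H u v).

Lemma normE u : `|u| = (nrm u)%:C.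
Proof. by rewrite /nrm RRe_real // ger0_real. Qed.

Lemma nrm_ge0 u : 0 <= nrm u.
Proof. by rewrite -ler0c -normE. Qed.

Lemma nrm0 : nrm 0 = 0.
Proof. by rewrite /nrm normr0. Qed.

Lemma nrm_eq0 u : nrm u = 0 -> u = 0.
Proof. by move=> e; apply/eqP; rewrite -normr_eq0 normE e. Qed.

Lemma ler_nrmD u v : nrm (u + v) <= nrm u + nrm v.
Proof. by rewrite -lecR rmorphD /= -!normE ler_normD. Qed.

Lemma nrmZ c u : nrm (c *: u) = complex.Re `|c| * nrm u.
Proof.
apply: complexI; rewrite -normE normrZ normE rmorphM /=.
by rewrite RRe_real // ger0_real.
Qed.

Lemma nrmZr t u : nrm (t%:C *: u) = `|t| * nrm u.
Proof. by rewrite nrmZ normc_def /= expr0n addr0 sqrtr_sqr. Qed.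

Lemma nrmN u : nrm (- u) = nrm u.
Proof. by rewrite /nrm normrN. Qed.

Lemma nrmB u v : nrm (u - v) = nrm (v - u).
Proof. by rewrite -nrmN opprB. Qed.

Lemma ripE u : rip u u = nrm u ^+ 2.
Proof. by rewrite /rip innerE normE -rmorphXn. Qed.

Lemma innerDl u v w : inner H (u + v) w = inner H u w + inner H v w.
Proof. exact: linearDl. Qed.
Lemma innerDr u v w : inner H w (u + v) = inner H w u + inner H w v.
Proof. exact: linearDr. Qed.
Lemma innerZl c u v : inner H (c *: u) v = c * inner H u v.
Proof. exact: linearZl_LR. Qed.
Lemma innerNl u v : inner H (- u) v = - inner H u v.
Proof. exact: linearNl. Qed.
Lemma innerNr u v : inner H u (- v) = - inner H u v.
Proof. exact: linearNr. Qed.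
Lemma innerC u v : inner H u v = (inner H v u)^*.
Proof. by rewrite (hermC (inner H)) expr0 mul1r. Qed.
Lemma innerZr c u v : inner H u (c *: v) = c^* * inner H u v.
Proof. by rewrite innerC innerZl rmorphM /= -innerC. Qed.
Lemma inner0l u : inner H 0 u = 0.
Proof. exact: linear0l. Qed.
Lemma inner0r u : inner H u 0 = 0.
Proof. exact: linear0r. Qed.

Lemma ReD (a b : R[i]) : complex.Re (a + b) = complex.Re a + complex.Re b.
Proof. by case: a; case: b. Qed.
Lemma ReN (a : R[i]) : complex.Re (- a) = - complex.Re a.
Proof. by case: a. Qed.
Lemma ReMr t (a : R[i]) : complex.Re (t%:C * a) = t * complex.Re a.
Proof. by case: a => a b /=; rewrite mul0r subr0. Qed.

Lemma ripDl u v w : rip (u + v) w = rip u w + rip v w.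
Proof. by rewrite /rip innerDl ReD. Qed.
Lemma ripDr u v w : rip w (u + v) = rip w u + rip w v.
Proof. by rewrite /rip innerDr ReD. Qed.
Lemma ripNl u v : rip (- u) v = - rip u v.
Proof. by rewrite /rip innerNl ReN. Qed.
Lemma ripNr u v : rip u (- v) = - rip u v.
Proof. by rewrite /rip innerNr ReN. Qed.
Lemma ripC u v : rip u v = rip v u.
Proof. by rewrite /rip innerC; case: (inner H v u). Qed.
Lemma ripZl t u v : rip (t%:C *: u) v = t * rip u v.
Proof. by rewrite /rip innerZl ReMr. Qed.
Lemma ripZr t u v : rip u (t%:C *: v) = t * rip u v.
Proof. by rewrite ripC ripZl ripC. Qed.
Lemma rip0l u : rip 0 u = 0.
Proof. by rewrite /rip inner0l. Qed.
Lemma rip0r u : rip u 0 = 0.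
Proof. by rewrite /rip inner0r. Qed.

Lemma nrmD2 u v : nrm (u + v) ^+ 2 = nrm u ^+ 2 + 2 * rip u v + nrm v ^+ 2.
Proof. by rewrite -!ripE ripDl !ripDr (ripC v u); ring. Qed.

Lemma nrmB2 u v : nrm (u - v) ^+ 2 = nrm u ^+ 2 - 2 * rip u v + nrm v ^+ 2.
Proof. by rewrite nrmD2 nrmN ripNr; ring. Qed.

Lemma cauchy_schwarz u v : rip u v <= nrm u * nrm v.
Proof.
have [/nrm_eq0 ->|u0] := eqVneq (nrm u) 0; first by rewrite rip0l nrm0 mul0r.
have [/nrm_eq0 ->|v0] := eqVneq (nrm v) 0; first by rewrite rip0r nrm0 mulr0.
have a0 : 0 < nrm u by rewrite lt_neqAle eq_sym u0 nrm_ge0.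
have b0 : 0 < nrm v by rewrite lt_neqAle eq_sym v0 nrm_ge0.
have := sqr_ge0 (nrm ((nrm v)%:C *: u - (nrm u)%:C *: v)).
rewrite nrmB2 ripZl ripZr !nrmZr !ger0_norm ?nrm_ge0 //.
rewrite [X in 0 <= X](_ : _ =
  2 * (nrm u * nrm v) * (nrm u * nrm v - rip u v)); last by ring.
by rewrite pmulr_rge0 ?subr_ge0 // mulr_gt0 // mulr_gt0.
Qed.

Lemma hilbert_complete (u : nat -> H) :
  (forall e : R, 0 < e -> exists N, forall n m, (N <= n)%N -> (N <= m)%N ->
     nrm (u n - u m) < e) ->
  exists l, forall e : R, 0 < e -> exists N, forall n, (N <= n)%N ->
     nrm (l - u n) < e.
Proof.
move=> uc.
have /cauchy_cvgP/cvgrPdist_lt ul : cauchy (u @ \oo).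
  apply: cauchy_exP => e e0.
  have [e1 eE] : exists e1, e = e1%:C.
    by apply/complex_realP; rewrite gtr0_real.
  have [|N uN] := uc e1; first by rewrite -ltcR -eE.
  exists (u N), N => // n /= Nn.
  by rewrite -ball_normE /= normE eE ltcR uN.
exists (lim (u @ \oo)) => e e0.
have /ul[N _ uN] : 0 < e%:C by rewrite ltcR.
by exists N => n Nn; rewrite -ltcR -normE; exact: uN.
Qed.

Lemma small_eq0 (x : R) : 0 <= x -> (forall e, 0 < e -> x <= e) -> x = 0.
Proof.
move=> x0 xe; apply/eqP; rewrite eq_le x0 andbT; apply/ler_addgt0Pr => e e0.
by rewrite add0r xe.
Qed.

Definition closed_subspace (K : set H) :=
  [/\ K 0, forall c u v, K u -> K v -> K (c *: u + v) &
   forall l, (forall e : R, 0 < e -> exists2 u, K u & nrm (l - u) < e) -> K l].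

(* [w] minimises [|u|^2 - 2 Re (phi u)] on [K]; by the parallelogram identity
   every minimising sequence is Cauchy. *)
Lemma riesz (K : set H) (phi : H -> R[i]) (C : R) :
  closed_subspace K ->
  (forall c u v, K u -> K v -> phi (c *: u + v) = c * phi u + phi v) ->
  (forall u, K u -> complex.Re (phi u) <= C * nrm u) ->
  exists2 w, K w & forall u, K u -> inner H u w = phi u.
Proof.
move=> [K0 Klin Kcl] philin phiC.
pose f u := complex.Re (phi u); pose J u := nrm u ^+ 2 - 2 * f u.
have KZ t u : K u -> K (t%:C *: u) by move=> Ku; have := Klin t%:C _ _ Ku K0; rewrite addr0.
have phi0 : phi 0 = 0.
  have := philin 1 0 0 K0 K0; rewrite scale1r addr0 mul1r => E.
  by apply: (addIr (phi 0)); rewrite -E add0r.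
have fD t u v : K u -> K v -> f (t%:C *: u + v) = t * f u + f v.
  by move=> Ku Kv; rewrite /f philin // ReD ReMr.
have fZ t u : K u -> f (t%:C *: u) = t * f u.
  by move=> Ku; rewrite -[_ *: u]addr0 fD // /f phi0 addr0.
pose A := [set - J u | u in K].
have Aub : has_ubound A.
  exists (C ^+ 2) => _ [u /phiC fC <-].
  have := sqr_ge0 (nrm u - C); rewrite /J /f; lra.
have A0 : A !=set0 by exists (- J 0), 0.
have hsA : has_sup A by [].
pose s := sup A.
have JS u : K u -> - s <= J u.
  by move=> Ku; rewrite lerNl; apply: ub_le_sup => //; exists u.
have exu (e : R) : 0 < e -> exists2 u, K u & J u < - s + e.
  move=> e0; have [_ [u Ku <-]] := sup_adherent e0 hsA; rewrite -/s => lt.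
  by exists u => //; lra.
have par u v : K u -> K v -> nrm (u - v) ^+ 2 <= 2 * (J u + s) + 2 * (J v + s).
  move=> Ku Kv; have Kh : K ((2^-1)%:C *: (1%:C *: u + v)) by apply: KZ; exact: Klin.
  have := JS _ Kh; rewrite /J fZ ?fD //; last exact: Klin.
  rewrite nrmZr scale1r mul1r ger0_norm ?invr_ge0 // exprMn nrmB2 nrmD2.
  by rewrite expr2; lra.
have [u_ u_P] : exists u_ : nat -> H, forall n, K (u_ n) /\ J (u_ n) < - s + n.+1%:R^-1.
  have /choice[u_ u_P] : forall n : nat, exists u, K u /\ J u < - s + n.+1%:R^-1.
    by move=> n; have [|u Ku Ju] := exu n.+1%:R^-1; [rewrite invr_gt0|exists u].
  by exists u_.
have par_ (e : R) n m N : (N <= n)%N -> (N <= m)%N ->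
    N.+1%:R^-1 <= e ^+ 2 / 4 -> 0 < e -> nrm (u_ n - u_ m) <= e.
  move=> Nn Nm Ne e0; rewrite -(@ler_pXn2r _ 2) ?nnegrE ?nrm_ge0 ?(ltW e0) //.
  have [Kn Jn] := u_P n; have [Km Jm] := u_P m.
  apply: le_trans (par _ _ Kn Km) _.
  have : n.+1%:R^-1 <= N.+1%:R^-1 :> R by rewrite lef_pV2 ?posrE // ler_nat.
  have : m.+1%:R^-1 <= N.+1%:R^-1 :> R by rewrite lef_pV2 ?posrE // ler_nat.
  move: (J _) (J _) Jn Jm Ne => a b.
  move: (n.+1%:R^-1) (m.+1%:R^-1) (N.+1%:R^-1) => x y z.
  lra.
have small (e : R) : 0 < e -> exists N : nat, N.+1%:R^-1 <= e.
  move=> e0; have [N] := ltr_add_invr e0; rewrite add0r => /ltW Ne.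
  by exists N.
have [w wP] : exists w, forall e : R, 0 < e -> exists N, forall n, (N <= n)%N -> nrm (w - u_ n) < e.
  apply: hilbert_complete => e e0.
  have [|N Ne] := small ((e / 2) ^+ 2 / 4); first by rewrite divr_gt0 // exprn_gt0 // divr_gt0.
  exists N => n m Nn Nm; apply: (@le_lt_trans _ _ (e / 2)); last by lra.
  by apply: par_ Nm Ne _ => //; rewrite divr_gt0.
have Kw : K w.
  apply: Kcl => e e0; have [N /(_ _ (leqnn N)) wN] := wP e e0.
  by exists (u_ N) => //; have [] := u_P N.
(* The value of [J] at [w] is never computed: the first variation in the direction [v] is taken at
   the almost minimisers [u_ n], and only the inner product with [v] passes to the limit. *)
have D_ge0 v : K v -> 0 <= rip w v - f v.
  move=> Kv; have n0 := nrm_ge0 v.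
  have var t : 0 < t -> 0 <= 2 * t * (rip w v - f v) + t ^+ 2 * nrm v ^+ 2.
    move=> t0; apply/ler_addgt0Pr => e e0.
    have e20 : 0 < e / 2 by rewrite divr_gt0.
    have d0 : 0 < 2 * t * (nrm v + 1) by rewrite mulr_gt0 // ?mulr_gt0 //; lra.
    have [N1 wN] := wP (e / 2 / (2 * t * (nrm v + 1))) (divr_gt0 e20 d0).
    have [N2 Ne] := small (e / 2) e20.
    pose n := maxn N1 N2.
    have /ltW := wN n (leq_maxl _ _); rewrite ler_pdivlMr // => wn.
    have {Ne} ne : n.+1%:R^-1 <= e / 2.
      by apply: le_trans Ne; rewrite lef_pV2 ?posrE // ler_nat ltnS leq_maxr.
    have [Kn Jn] := u_P n.
    have := JS _ (Klin t%:C _ _ Kv Kn); rewrite {1}/J fD // nrmD2 ripZl nrmZr.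
    rewrite (ger0_norm (ltW t0)) exprMn => ineq.
    have cs := cauchy_schwarz (u_ n - w) v.
    rewrite nrmB ripDl ripNl in cs.
    have cs' : t * (rip (u_ n) v - rip w v) <= t * (nrm (w - u_ n) * nrm v).
      by rewrite ler_pM2l.
    have : 0 <= t * nrm (w - u_ n) by rewrite mulr_ge0 ?nrm_ge0 // ltW.
    rewrite /J in Jn ineq; rewrite (ripC v) in ineq.
    move: n.+1%:R^-1 (f v) (f (u_ n)) (rip w v) (rip (u_ n) v) (nrm (w - u_ n))
      (nrm v) (nrm (u_ n)) ne Jn ineq wn cs' => a b c d g h i j.
    clear -e0; move=> H1 H2 H3 H4 H5 H6.
    lra.
  rewrite leNgt; apply/negP => D0; set D := rip w v - f v in var D0.
  have q0 : 0 < nrm v ^+ 2 + 1 by have := sqr_ge0 (nrm v); lra.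
  (* This is nearly the minimiser [- D / |v|^2] of the quadratic; the added 1 also covers
     [v = 0]. *)
  have := var (- D / (nrm v ^+ 2 + 1)); rewrite divr_gt0 ?oppr_gt0 // => /(_ isT).
  rewrite leNgt => /negP; apply.
  set q := nrm v ^+ 2 + 1 in q0 *.
  have -> : nrm v ^+ 2 = q - 1 by rewrite /q addrK.
  rewrite [ltLHS](_ : _ = - (D ^+ 2 / q ^+ 2) * (q + 1)); last first.
    by field; rewrite gt_eqF.
  rewrite mulNr oppr_lt0; apply: mulr_gt0; last lra.
  apply: divr_gt0; last exact: exprn_gt0.
  by rewrite exprn_even_gt0 //= lt_eqF.
have Re_eq v : K v -> rip v w = f v.
  move=> Kv; have := D_ge0 _ Kv; have := D_ge0 _ (KZ (-1) _ Kv).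
  by rewrite fZ // ripZr (ripC v); lra.
exists w => // u Ku.
(* Real parts at ['i *: u] give the imaginary parts at [u]. *)
have Kiu : K ('i *: u) by have := Klin 'i _ _ Ku K0; rewrite addr0.
have := Re_eq _ Ku; have := Re_eq _ Kiu.
have -> : f ('i *: u) = complex.Re ('i * phi u).
  by rewrite /f -[_ *: _]addr0 philin // phi0 addr0.
rewrite /f /rip innerZl; case: (inner H u w) (phi u) => a b [a' b'] /=.
by move=> e ->; congr (_ +i* _); lra.
Qed.

Definition is_proj_on (e : H -> H) (K : set H) :=
  (forall u, K (e u)) /\ forall u v, K v -> inner H (u - e u) v = 0.

(** [e u] is the Riesz vector in [K] of the functional [v |-> <v, u>]. *)
Lemma projection_exists (K : set H) : closed_subspace K ->
  exists e, is_proj_on e K.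
Proof.
move=> cK; have [_ Klin _] := cK.
have /choice[e eP] : forall u, exists w, K w /\ forall v, K v -> inner H v w = inner H v u.
  move=> u; have [|v Kv|w Kw wP] := @riesz K (fun v => inner H v u) (nrm u) cK.
  - by move=> c v v' _ _; rewrite innerDl innerZl.
  - by rewrite mulrC; exact: cauchy_schwarz.
  - by exists w.
exists e; split=> [u|u v Kv]; first by have [] := eP u.
by have [_ /(_ _ Kv) E] := eP u; rewrite innerDl innerNl (innerC u) (innerC (e u)) E subrr.
Qed.

End Hilbert.

(** * Bounded operators and adjoints *)

Section Operators.
Variables (R : realType) (H : hilbertType R).
Implicit Types (u v w : H) (t : R) (c : R[i]) (A B e f : H -> H).

Lemma bounded_operatorP A : bounded_operator A <->
  linear A /\ exists2 C : R, 0 <= C & forall u, nrm (A u) <= C * nrm u.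
Proof.
split=> [[linA [C AC]]|[linA [C C0 AC]]]; split=> //; last first.
  by exists C%:C => u; rewrite !normE -rmorphM lecR.
exists (Num.max 0 (complex.Re C)) => [|u]; first by rewrite le_max lexx.
have := AC u; rewrite !normE lecE /= => /andP[_].
case: (C) => a b /=; rewrite mulr0 subr0 => /le_trans; apply.
by apply: ler_wpM2r; rewrite ?nrm_ge0 // le_max lexx orbT.
Qed.

Section OneOperator.
Variable A : H -> H.
Hypothesis bA : bounded_operator A.

Lemma opP c u v : A (c *: u + v) = c *: A u + A v.
Proof. by case: bA => linA _; exact: linA. Qed.
Lemma opD u v : A (u + v) = A u + A v.
Proof. by rewrite -[u]scale1r opP !scale1r. Qed.
Lemma op0 : A 0 = 0.
Proof. by apply: (addIr (A 0)); rewrite -opD !add0r. Qed.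
Lemma opZ c u : A (c *: u) = c *: A u.
Proof. by rewrite -[_ *: u]addr0 opP op0 addr0. Qed.
Lemma opN u : A (- u) = - A u.
Proof. by rewrite -scaleN1r opZ scaleN1r. Qed.
Lemma opB u v : A (u - v) = A u - A v.
Proof. by rewrite opD opN. Qed.
Lemma op_sum I (r : seq I) (P : pred I) (F : I -> H) :
  A (\sum_(i <- r | P i) F i) = \sum_(i <- r | P i) A (F i).
Proof. by apply: (big_morph A opD op0). Qed.
Lemma op_comp0 : A \o (0 : H -> H) = 0.
Proof. by apply/funext => u /=; rewrite op0. Qed.
Lemma op_compD (B1 B2 : H -> H) : A \o (B1 + B2) = (A \o B1) + (A \o B2).
Proof. by apply/funext => u /=; rewrite opD. Qed.
Lemma op_compZ c B : A \o (c *: B) = c *: (A \o B).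
Proof. by apply/funext => u /=; rewrite opZ. Qed.
Lemma op_comp_sum I (r : seq I) (P : pred I) (F : I -> H -> H) :
  A \o (\sum_(i <- r | P i) F i) = \sum_(i <- r | P i) (A \o F i).
Proof. by apply: (big_morph (fun B => A \o B) op_compD op_comp0). Qed.

(** The Riesz theorem on the whole space supplies a witness for the condition in [adjoint], so
    [xget] does not return its default. *)
Lemma adjointE u v : inner H (A u) v = inner H u (adjoint A v).
Proof.
suff [B BP] : exists B : H -> H, forall u v, inner H (A u) v = inner H u (B v).
  exact: (xgetPex 0 (ex_intro
    (fun B : H -> H => forall u v, inner H (A u) v = inner H u (B v)) B BP)).
have [_ [C C0 AC]] := (bounded_operatorP A).1 bA.
have /choice[B BP] : forall v, exists w, forall u, inner H u w = inner H (A u) v.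
  move=> {}v; have [|||w _ wP] := @riesz _ _ setT (fun u => inner H (A u) v) (C * nrm v).
  - by split.
  - by move=> c {}u u' _ _; rewrite opP innerDl innerZl.
  - move=> {}u _; apply: le_trans (cauchy_schwarz _ _) _.
    by rewrite mulrAC ler_wpM2r ?nrm_ge0.
  - by exists w => {}u; exact: wP.
by exists B => {}u {}v; rewrite BP.
Qed.

Lemma adjointEr u v : inner H u (A v) = inner H (adjoint A u) v.
Proof. by rewrite innerC adjointE -innerC. Qed.

Lemma op_norm_bound : exists2 C : R, 0 <= C & forall u, nrm (A u) <= C * nrm u.
Proof. by case: (bounded_operatorP A).1. Qed.

End OneOperator.

Lemma inner_eq0 u : inner H u u = 0 -> u = 0.
Proof. by rewrite innerE => /eqP; rewrite sqrf_eq0 normr_eq0 => /eqP. Qed.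

Lemma inner_extr u v : (forall w, inner H w u = inner H w v) -> u = v.
Proof.
by move=> E; apply/eqP; rewrite -subr_eq0; apply/eqP/inner_eq0; rewrite innerDr innerNr E subrr.
Qed.

Lemma inner_extl u v : (forall w, inner H u w = inner H v w) -> u = v.
Proof. by move=> E; apply: inner_extr => w; rewrite innerC E -innerC. Qed.

Lemma adjoint_unique A B : (forall u v, inner H (A u) v = inner H u (B v)) ->
  adjoint A = B.
Proof.
move=> AB; apply/funext => v; apply: inner_extr => w; rewrite -AB.
have := xgetPex 0 (ex_intro (fun B : H -> H => forall u v, inner H (A u) v = inner H u (B v)) B AB).
by move=> ->.
Qed.

Lemma adjoint_bounded A : bounded_operator A -> bounded_operator (adjoint A).
Proof.
move=> bA; apply/bounded_operatorP; split.
  move=> c u v; apply: inner_extr => w.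
  by rewrite innerDr innerZr -!adjointE // innerDr innerZr.
have [C C0 AC] := op_norm_bound bA; exists C => // u.
have [->|n0] := eqVneq (nrm (adjoint A u)) 0; first by rewrite mulr_ge0 ?nrm_ge0.
have n_gt0 : 0 < nrm (adjoint A u) by rewrite lt_neqAle eq_sym n0 nrm_ge0.
rewrite -(ler_pM2l n_gt0) -expr2 -ripE /rip -adjointE //.
apply: le_trans (cauchy_schwarz _ _) _.
by rewrite mulrCA mulrA ler_wpM2r ?nrm_ge0.
Qed.

Lemma adjointK A : bounded_operator A -> adjoint (adjoint A) = A.
Proof. by move=> bA; apply: adjoint_unique => u v; rewrite adjointEr. Qed.

Lemma adjoint_comp A B : bounded_operator A -> bounded_operator B ->
  adjoint (A \o B) = adjoint B \o adjoint A.
Proof. by move=> bA bB; apply: adjoint_unique => u v /=; rewrite !adjointE. Qed.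

Lemma adjointD A B : bounded_operator A -> bounded_operator B ->
  adjoint (A + B) = adjoint A + adjoint B.
Proof.
by move=> bA bB; apply: adjoint_unique => u v /=; rewrite innerDl innerDr !adjointE.
Qed.

Lemma adjointZ c A : bounded_operator A -> adjoint (c *: A) = c^* *: adjoint A.
Proof.
move=> bA; apply: adjoint_unique => u v /=.
by rewrite innerZl innerZr conjCK adjointE.
Qed.

Lemma adjoint_id : adjoint (@id H) = id.
Proof. exact: adjoint_unique. Qed.

Lemma bounded_comp A B :
  bounded_operator A -> bounded_operator B -> bounded_operator (A \o B).
Proof.
move=> bA bB; apply/bounded_operatorP; split=> [c u v|]; first by rewrite /= !opP.
have [C C0 AC] := op_norm_bound bA; have [D D0 BD] := op_norm_bound bB.
exists (C * D) => [|u]; first exact: mulr_ge0.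
by apply: le_trans (AC _) _; rewrite -mulrA ler_wpM2l.
Qed.

Lemma bounded_lin c A B :
  bounded_operator A -> bounded_operator B -> bounded_operator (c *: A + B).
Proof.
move=> bA bB; apply/bounded_operatorP; split=> [c' u v|].
  change (c *: A (c' *: u + v) + B (c' *: u + v) =
          c' *: (c *: A u + B u) + (c *: A v + B v)).
  by rewrite (opP bA) (opP bB) !scalerDr !scalerA (mulrC c) addrACA.
have [C C0 AC] := op_norm_bound bA; have [D D0 BD] := op_norm_bound bB.
exists (complex.Re `|c| * C + D) => [|u].
  by rewrite addr_ge0 // mulr_ge0 // -ler0c RRe_real // ger0_real.
apply: le_trans (ler_nrmD _ _) _; rewrite mulrDl lerD // nrmZ -mulrA ler_wpM2l //.
by rewrite -ler0c RRe_real // ger0_real.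
Qed.

Lemma bounded_id : bounded_operator (@id H).
Proof. by split=> [//|]; exists 1 => u; rewrite mul1r. Qed.

Lemma bounded0 : bounded_operator (0 : H -> H).
Proof.
split=> [c u v|]; first by rewrite scaler0 addr0.
by exists 0 => u; rewrite normr0 mul0r.
Qed.

End Operators.

(** * Projections in a von Neumann algebra *)

Section VonNeumann.
Variables (R : realType) (H : hilbertType R) (M : set (H -> H)).
Hypothesis hM : von_neumann_algebra M.
Implicit Types (u v w : H) (t : R) (c : R[i]) (A B e f x y m : H -> H).

Lemma M_bounded x : M x -> bounded_operator x.
Proof. by case: hM => + _ _; apply. Qed.
Hint Resolve M_bounded : core.

Lemma M_adj x : M x -> M (adjoint x).
Proof. by case: hM => _ + _; apply. Qed.

(** The bicommutant condition as a membership test. All closure properties of [M], including those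
    under limits and kernel projections, are drawn from it. *)
Lemma M_intro x : bounded_operator x ->
  (forall B, commutant M B -> forall u, x (B u) = B (x u)) -> M x.
Proof.
move=> bx xB; case: hM => _ _ <-; split=> // B MB.
by apply/funext => u /=; rewrite xB.
Qed.

Lemma commutantE B x u : commutant M B -> M x -> x (B u) = B (x u).
Proof. by move=> [_ BM] /BM/(congr1 (@^~ u)). Qed.

Lemma commutant_adjoint B : commutant M B -> commutant M (adjoint B).
Proof.
move=> BM; have [bB _] := BM; split=> [|x Mx]; first exact: adjoint_bounded.
have bx := M_bounded Mx; have Max := M_adj Mx; have bax := M_bounded Max.
apply/funext => u /=; apply: inner_extr => w.
by rewrite adjointEr // -!adjointE // -commutantE // adjointEr // adjointK.
Qed.

Lemma M_id : M id.
Proof. by apply: M_intro => //; exact: bounded_id. Qed.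

Lemma M_zero : M 0.
Proof.
apply: M_intro => [|B [bB _] u]; first exact: bounded0.
change (0 = B 0).
by rewrite op0.
Qed.

Lemma M_lin c x y : M x -> M y -> M (c *: x + y).
Proof.
move=> Mx My; apply: M_intro => [|B BM u]; first by apply: bounded_lin; auto.
have [bB _] := BM.
by change (c *: x (B u) + y (B u) = B (c *: x u + y u)); 
  rewrite opP // (commutantE u BM Mx) (commutantE u BM My).
Qed.

Lemma M_comp x y : M x -> M y -> M (x \o y).
Proof.
move=> Mx My; apply: M_intro => [|B BM u /=]; first by apply: bounded_comp; auto.
by rewrite (commutantE u BM My) (commutantE _ BM Mx).
Qed.

Lemma M_add x y : M x -> M y -> M (x + y).
Proof. by move=> Mx My; rewrite -[x]scale1r; exact: M_lin. Qed.

Lemma M_scale c x : M x -> M (c *: x).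
Proof. by move=> Mx; rewrite -[_ *: x]addr0; apply: M_lin => //; exact: M_zero. Qed.

Lemma M_opp x : M x -> M (- x).
Proof. by move=> Mx; rewrite -scaleN1r; exact: M_scale. Qed.

Lemma M_sub x y : M x -> M y -> M (x - y).
Proof. by move=> Mx My; apply: M_add => //; exact: M_opp. Qed.

Lemma M_sum I (r : seq I) (P : pred I) (F : I -> H -> H) :
  (forall i, P i -> M (F i)) -> M (\sum_(i <- r | P i) F i).
Proof.
by move=> MF; apply: (big_ind M) => // [|x y]; [exact: M_zero|exact: M_add].
Qed.

Lemma adjointB_M x y : M x -> M y -> adjoint (x - y) = adjoint x - adjoint y.
Proof.
move=> Mx My; rewrite -scaleN1r adjointD ?adjointZ; auto; last by apply: M_bounded; exact: M_scale.
by rewrite rmorphN rmorph1 scaleN1r.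
Qed.

Section Projection.
Variable e : H -> H.
Hypothesis Pe : projection_in M e.

Lemma proj_M : M e. Proof. by case: Pe. Qed.
Lemma proj_idem u : e (e u) = e u.
Proof. by case: Pe => _ _ /(congr1 (@^~ u)). Qed.
Lemma proj_bounded : bounded_operator e.
Proof. exact: M_bounded proj_M. Qed.
Lemma projE u v : inner H (e u) v = inner H u (e v).
Proof. by rewrite (adjointE proj_bounded); case: Pe => _ ->. Qed.
Lemma proj_inner u : inner H (e u) u = inner H (e u) (e u).
Proof. by rewrite -projE proj_idem. Qed.
Lemma proj_nrm u : nrm (e u) <= nrm u.
Proof.
have [->|n0] := eqVneq (nrm (e u)) 0; first exact: nrm_ge0.
have n_gt0 : 0 < nrm (e u) by rewrite lt_neqAle eq_sym n0 nrm_ge0.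
rewrite -(ler_pM2l n_gt0) -expr2 -ripE /rip -proj_inner; exact: cauchy_schwarz.
Qed.
End Projection.

(* The projection is [1 - k], where [k] projects onto the common kernel: [k]
   lies in the bicommutant of [M]. *)
Lemma kernel_support (S : set (H -> H)) : S `<=` M -> exists f,
  [/\ projection_in M f,
      forall u, f u = 0 <-> forall x, S x -> x u = 0
    & (forall x m, S x -> M m -> S (x \o m)) -> forall m, M m -> f \o m = m \o f].
Proof.
move=> SM; pose K := [set u | forall x, S x -> x u = 0].
have cK : closed_subspace K.
  split=> [x Sx|c u v Ku Kv x Sx|l lK x Sx]; have bx := M_bounded (SM _ Sx).
  - by rewrite op0.
  - by rewrite opP // Ku // Kv // scaler0 addr0.
  - have [C C0 xC] := op_norm_bound bx.
    apply: nrm_eq0; apply: small_eq0 => [|d d0]; first exact: nrm_ge0.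
    have C1 : 0 < C + 1 by rewrite ltr_wpDl.
    have [u Ku lu] := lK _ (divr_gt0 d0 C1).
    rewrite -[x l]subr0 -(Ku _ Sx) -opB //; apply: le_trans (xC _) _.
    apply: (@le_trans _ _ ((C + 1) * nrm (l - u))).
      by rewrite ler_wpM2r ?nrm_ge0 // lerDl.
    by rewrite mulrC -ler_pdivlMr // ltW.
have [k [kK kort]] := projection_exists cK.
have [K0 Klin _] := cK.
have KB u v : K u -> K v -> K (u - v).
  by move=> Ku Kv; rewrite -scaleN1r addrC; exact: Klin.
have uniq u w : K w -> (forall v, K v -> inner H (u - w) v = 0) -> w = k u.
  move=> Kw wort; apply/eqP; rewrite -subr_eq0; apply/eqP/inner_eq0.
  rewrite [X in inner H X _](_ : _ = (u - k u) - (u - w)); last first.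
    by rewrite opprB [RHS]addrC addrA subrK.
  by rewrite innerDl innerNl kort ?wort ?subr0 //; exact: KB.
have kid u : K u -> k u = u.
  by move=> Ku; rewrite -(uniq u u) // => v _; rewrite subrr inner0l.
have klin c u v : k (c *: u + v) = c *: k u + k v.
  rewrite -(uniq _ (c *: k u + k v)) //; first exact: Klin.
  move=> w Kw; rewrite [X in inner H X _](_ : _ = c *: (u - k u) + (v - k v)).
    by rewrite innerDl innerZl !kort // mulr0 addr0.
  by rewrite scalerBr opprD addrACA.
have ksym u v : inner H (k u) v = inner H u (k v).
  have /subr0_eq e1 : inner H v (k u) - inner H (k v) (k u) = 0.
    by rewrite -innerNl -innerDl kort.
  have /subr0_eq e2 : inner H u (k v) - inner H (k u) (k v) = 0.
    by rewrite -innerNl -innerDl kort.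
  by rewrite innerC e1 -innerC e2.
have bk : bounded_operator k.
  apply/bounded_operatorP; split=> [c u v|]; first exact: klin.
  exists 1 => // u; rewrite mul1r -(@ler_pXn2r _ 2) ?nnegrE ?nrm_ge0 //.
  rewrite -[in leRHS](subrK (k u) u) nrmD2 /rip kort // mulr0 addr0 lerDr.
  exact: sqr_ge0.
(* An operator that leaves [K] invariant, together with its adjoint, commutes with the projection on
   [K]. The commutant of [M] consists of such operators because they commute with [S]. *)
have kcomm B : bounded_operator B -> (forall u, K u -> K (B u)) ->
    (forall u, K u -> K (adjoint B u)) -> forall u, k (B u) = B (k u).
  move=> bB BK BaK u; rewrite -(uniq _ (B (k u))) //; first exact: BK.
  by move=> v Kv; rewrite -opB // adjointE // kort //; exact: BaK.
have Mk : M k.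
  apply: M_intro => // B BM u; apply: kcomm; first by case: BM.
    move=> {}u Ku x Sx; rewrite commutantE //; last exact: SM.
    by rewrite Ku // op0 //; case: BM.
  have BaM := commutant_adjoint BM.
  move=> {}u Ku x Sx; rewrite commutantE //; last exact: SM.
  by rewrite Ku // op0 //; case: BaM.
have ak : adjoint k = k by exact: adjoint_unique.
have kk u : k (k u) = k u by exact: kid.
have Mf : M (id - k) by apply: M_sub => //; exact: M_id.
exists (id - k); split.
- split=> //; first by rewrite (adjointB_M M_id Mk) adjoint_id ak.
  apply/funext => u.
  change ((u - k u) - k (u - k u) = u - k u).
  by rewrite opB // kk subrr subr0.
- move=> u; change (u - k u = 0 <-> K u); split=> [/eqP|/kid ->]; last by rewrite subrr.
  by rewrite subr_eq0 => /eqP ->.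
(* Stability of [S] under right multiplication makes [K] invariant under [M], whence [f] is
   central. *)
- move=> SMS m Mm; apply/funext => u.
  change (m u - k (m u) = m (u - k u)); rewrite (opB (M_bounded Mm)).
  rewrite (kcomm _ (M_bounded Mm)) //.
    by move=> {}u Ku x Sx; apply: (Ku (x \o m)); exact: SMS.
  by move=> {}u Ku x Sx; apply: (Ku (x \o adjoint m)); apply: SMS => //; exact: M_adj.
Qed.

(** The vector [u - e u] lies in the kernel of [e], hence in that of [f]; the second identity is the
    adjoint of the first. *)
Lemma proj_eq0_comp e f : projection_in M e -> projection_in M f ->
  (forall u, e u = 0 -> f u = 0) -> f \o e = f /\ e \o f = f.
Proof.
move=> Pe Pf ef; have fe u : f (e u) = f u.
  apply/eqP; rewrite -subr_eq0 -(opB (proj_bounded Pf)); apply/eqP/ef.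
  by rewrite (opB (proj_bounded Pe)) proj_idem // subrr.
split; first exact/funext.
by apply/funext => u /=; apply: inner_extr => w; rewrite -projE // -projE // fe projE.
Qed.

(** By [<x^* x u, u> = |x u|^2] the operators [x] and [x^* x] have the same kernel. The kernel
    projection of [x] is thus a support of [x^* x], and [xget] has something to choose. *)
Lemma right_support_kernel x : M x ->
  projection_in M (right_support M x) /\ forall u, right_support M x u = 0 <-> x u = 0.
Proof.
move=> Mx; have bx := M_bounded Mx; have Max := M_adj Mx.
have xx0 u : adjoint x (x u) = 0 -> x u = 0.
  by move=> E; apply: inner_eq0; rewrite adjointE // E inner0r.
have [|f [Pf f0 _]] := @kernel_support [set x]; first by move=> _ ->.
have f_supp : is_support M (adjoint x \o x) f.
  split=> // [|g Pg xg u].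
    apply/funext => u /=; congr (adjoint x _); apply/eqP.
    rewrite -subr_eq0 -opB //; apply/eqP; apply: (f0 _).1 => //.
    by rewrite (opB (proj_bounded Pf)) (proj_idem Pf) subrr.
  have [|fg gf] := @proj_eq0_comp g f Pg Pf.
    move=> v gv; apply/f0 => _ ->; apply: xx0.
    have /= <- := congr1 (@^~ v) xg.
    by rewrite /= gv op0 ?op0 //; exact: M_bounded.
  have [Mg ag gg] := Pg; have [Mf _ _] := Pf.
  have Pgf : projection_in M (g - f).
    split; first exact: M_sub.
      by rewrite adjointB_M // ag; case: Pf => _ ->.
    apply/funext => v; change (g (g v - f v) - f (g v - f v) = g v - f v).
    rewrite (opB (proj_bounded Pg)) (opB (proj_bounded Pf)) (proj_idem Pg) (proj_idem Pf).
    have /= -> := congr1 (@^~ v) gf; have /= -> := congr1 (@^~ v) fg.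
    by rewrite subrr subr0.
  change (0 <= inner H ((g - f) u) u).
  by rewrite proj_inner // innerE exprn_ge0.
(* Whichever support [xget] selects, its kernel is that of [x]: one inclusion comes from
   [x^* x r = x^* x], the other from minimality against [f]. *)
have [Pr xr rmin] : is_support M (adjoint x \o x) (right_support M x).
  exact: (xgetPex 0 (ex_intro (fun e => is_support M (adjoint x \o x) e) f f_supp)).
split=> // u; split=> [ru|xu].
  apply: xx0; have /= <- := congr1 (@^~ u) xr.
  by rewrite ru op0 ?op0 //; exact: M_bounded.
have fu : f u = 0 by apply/f0 => _ ->.
have := rmin f Pf (let: And3 _ h _ := f_supp in h) u.
rewrite innerDl innerNl fu inner0l add0r oppr_ge0 proj_inner // => le0.
apply: inner_eq0; apply/eqP; rewrite eq_le le0 /=.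
by rewrite innerE exprn_ge0.
Qed.

End VonNeumann.

(** * Decomposability as a condition on kernels; uniform limits in [M] *)

Section Spectral.
Variables (R : realType) (H : hilbertType R) (M : set (H -> H)).
Hypothesis hM : von_neumann_algebra M.
Implicit Types (u v w : H) (t : R) (A B e f x y : H -> H).

(** For projections [<e u, u> = |e u|^2]; inclusion of kernels gives [e = e f], hence
    [|e u| = |e (f u)| <= |f u|]. *)
Lemma op_le_projP e f : projection_in M e -> projection_in M f ->
  op_le e f <-> forall u, f u = 0 -> e u = 0.
Proof.
move=> Pe Pf; split=> [ef u fu|ef u].
  have := ef u; rewrite innerDl innerNl fu inner0l add0r oppr_ge0 (proj_inner hM Pe) => le0.
  by apply: inner_eq0; apply/eqP; rewrite eq_le le0 innerE exprn_ge0.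
have [_ fe] := proj_eq0_comp hM Pf Pe ef.
have [ef' _] := proj_eq0_comp hM Pf Pe ef.
rewrite innerDl innerNl (proj_inner hM Pf) (proj_inner hM Pe) subr_ge0 !innerE.
have <- : e (f u) = e u by have := congr1 (@^~ u) ef'.
by rewrite !normE -!rmorphXn lecR ler_pXn2r ?nnegrE ?nrm_ge0 // (proj_nrm hM Pe).
Qed.

Lemma decomposable_kernel (X : set (H -> H)) T : X `<=` M ->
  (forall x, X x -> M (T x)) ->
  decomposable X M T <-> forall x u, X x -> x u = 0 -> T x u = 0.
Proof.
move=> XM TM; split=> [dT x u Xx xu|kT x Xx].
  have [Px x0] := right_support_kernel hM (XM _ Xx).
  have [PT T0] := right_support_kernel hM (TM _ Xx).
  by apply/T0; apply: ((op_le_projP PT Px).1 (dT _ Xx)); apply/x0.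
have [Px x0] := right_support_kernel hM (XM _ Xx).
have [PT T0] := right_support_kernel hM (TM _ Xx).
by apply/(op_le_projP PT Px) => u /x0 xu; apply/T0; exact: kT.
Qed.

Lemma small_mul_eq0 (x K : R) : 0 <= x -> (forall d, 0 < d -> x <= d * K) -> x = 0.
Proof.
move=> x0 xK; have K0 : 0 <= K by have := xK 1 ltr01; rewrite mul1r; apply: le_trans.
have K1 : 0 < K + 1 by lra.
apply: small_eq0 => // d d0; apply: le_trans (xK (d / (K + 1)) _) _.
  exact: divr_gt0.
by rewrite mulrAC ler_pdivrMr // ler_pM2l // lerDl.
Qed.

(** The increasing bounded scalars [t] dominate the increments, so [Y] is uniformly Cauchy, and
    commutation with the commutant survives in the limit. Applied to the square root iteration and
    to the sum of the humps. *)
Lemma operator_limit (Y : nat -> H -> H) (t : nat -> R) (t1 : R) :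
  (forall n, M (Y n)) -> (forall n, t n <= t n.+1) -> (forall n, t n <= t1) ->
  (forall n u, nrm (Y n.+1 u - Y n u) <= (t n.+1 - t n) * nrm u) ->
  exists2 Z, M Z & forall d : R, 0 < d -> exists N, forall n, (N <= n)%N ->
    forall u, nrm (Z u - Y n u) <= d * nrm u.
Proof.
move=> MY tS tb Yt.
have tm n m : (n <= m)%N -> t n <= t m.
  move=> /subnK <-; elim: (m - n)%N => [//|k IH].
  by rewrite addSn; apply: le_trans IH (tS _).
have Ynm n m u : (n <= m)%N -> nrm (Y m u - Y n u) <= (t m - t n) * nrm u.
  move=> /subnK <-; elim: (m - n)%N => [|k IH]; first by rewrite !subrr nrm0 mul0r.
  rewrite addSn -(subrK (Y (k + n)%N u) (Y (k + n).+1 u)) -addrA.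
  apply: le_trans (ler_nrmD _ _) _; apply: le_trans (lerD (Yt _ _) IH) _.
  by rewrite -mulrDl addrA subrK.
have ht : has_sup (range t).
  by split; [exists (t 0), 0|exists t1 => _ [n _ <-]].
have ts n : t n <= sup (range t) by apply: ub_le_sup; [case: ht|exists n].
have tc (d : R) : 0 < d -> exists N, forall n m, (N <= n <= m)%N -> t m - t n <= d.
  move=> d0; have [_ [N _ <-] tN] := sup_adherent d0 ht.
  exists N => n m /andP[Nn nm]; have := tm _ _ Nn; have := ts m.
  move: (sup _) tN => s; lra.
have Yc (d : R) : 0 < d -> exists N, forall n m u, (N <= n)%N -> (N <= m)%N ->
    nrm (Y n u - Y m u) <= d * nrm u.
  move=> d0; have [N tN] := tc _ d0; exists N => n m u Nn Nm.
  have [nm|/ltnW mn] := leqP n m.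
    rewrite nrmB; apply: le_trans (Ynm _ _ _ nm) _.
    by rewrite ler_wpM2r ?nrm_ge0 // tN // Nn.
  apply: le_trans (Ynm _ _ _ mn) _.
  by rewrite ler_wpM2r ?nrm_ge0 // tN // Nm.
have /choice[Z ZP] : forall u, exists l, forall d : R, 0 < d -> exists N, forall n,
    (N <= n)%N -> nrm (l - Y n u) < d.
  move=> u; apply: hilbert_complete => d d0.
  have u1 : 0 < nrm u + 1 by rewrite ltr_wpDl ?nrm_ge0.
  have [N YN] := Yc _ (divr_gt0 d0 u1); exists N => n m Nn Nm.
  apply: le_lt_trans (YN _ _ _ Nn Nm) _.
  by rewrite mulrAC ltr_pdivrMr // ltr_pM2l // ltrDl.
have Zu (d : R) : 0 < d -> exists N, forall n, (N <= n)%N ->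
    forall u, nrm (Z u - Y n u) <= d * nrm u.
  move=> d0; have [N YN] := Yc _ d0; exists N => n Nn u.
  apply/ler_addgt0Pr => d' d'0; have [N' ZN'] := ZP u _ d'0.
  rewrite -(subrK (Y (maxn N N') u) (Z u)) -addrA addrC.
  apply: le_trans (ler_nrmD _ _) _; apply: lerD.
    by apply: YN => //; exact: leq_maxl.
  by apply/ltW/ZN'; exact: leq_maxr.
exists Z => //; apply: (M_intro hM).
  apply/bounded_operatorP; split=> [c u v|].
    apply/eqP; rewrite -subr_eq0; apply/eqP/nrm_eq0.
    apply: (@small_mul_eq0 _ (nrm (c *: u + v) + nrm (c *: u) + nrm v)) => [|d d0].
      exact: nrm_ge0.
    have [N ZN] := Zu _ d0; have bY : bounded_operator (Y N) by exact: M_bounded (MY N).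
    have -> : Z (c *: u + v) - (c *: Z u + Z v) =
        (Z (c *: u + v) - Y N (c *: u + v)) + (c *: (Y N u - Z u) + (Y N v - Z v)).
      by rewrite (opP bY) scalerBr (addrACA (c *: Y N u)) -opprD [RHS]addrA subrK.
    apply: le_trans (ler_nrmD _ _) _; rewrite -addrA mulrDr.
    apply: lerD; first exact: ZN.
    apply: le_trans (ler_nrmD _ _) _; rewrite mulrDr.
    apply: lerD; last by rewrite nrmB; exact: ZN.
    rewrite !nrmZ mulrCA; apply: ler_wpM2l; last by rewrite nrmB; exact: ZN.
    by rewrite -ler0c RRe_real // ger0_real.
  have [N /(_ _ (leqnn _)) ZN] := Zu _ ltr01.
  have [C C0 YC] := op_norm_bound (M_bounded hM (MY N)).
  exists (1 + C) => [|u]; first by rewrite addr_ge0.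
  rewrite -(subrK (Y N u) (Z u)); apply: le_trans (ler_nrmD _ _) _.
  by rewrite mulrDl lerD.
move=> B BM u; have [bB _] := BM; have [C C0 BC] := op_norm_bound bB.
apply/eqP; rewrite -subr_eq0; apply/eqP/nrm_eq0.
apply: (@small_mul_eq0 _ (nrm (B u) + C * nrm u)) => [|d d0]; first exact: nrm_ge0.
have [N /(_ _ (leqnn _)) ZN] := Zu _ d0.
have -> : Z (B u) - B (Z u) = (Z (B u) - Y N (B u)) + B (Y N u - Z u).
  by rewrite opB // (commutantE u BM (MY N)) addrA subrK.
apply: le_trans (ler_nrmD _ _) _; rewrite mulrDr; apply: lerD => //.
by apply: le_trans (BC _) _; rewrite mulrCA ler_wpM2l // nrmB.
Qed.


End Spectral.

(** * Spectral projections *)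

Section SquareRoot.
Variables (R : realType) (H : hilbertType R) (M : set (H -> H)).
Hypothesis hM : von_neumann_algebra M.
Implicit Types (u v w : H) (t : R) (A B e f x y : H -> H).
Let Mb x : M x -> bounded_operator x := @M_bounded R H M hM x.
Hint Resolve Mb : core.

Definition symmetric_op A := forall u v, inner H (A u) v = inner H u (A v).

Lemma symmetric_rip A : bounded_operator A ->
  (forall u v, rip (A u) v <= rip u (A v)) -> symmetric_op A.
Proof.
move=> bA le.
have eq u v : rip (A u) v = rip u (A v).
  by apply/eqP; rewrite eq_le le /= ripC (ripC (A u)).
move=> u v; have := eq u v; have := eq ('i *: u) v.
rewrite /rip (opZ bA) !innerZl.
case: (inner H (A u) v) (inner H u (A v)) => a b [c d] /=.
by move=> e1 ->; congr (_ +i* _); lra.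
Qed.

Lemma le_small_mul (x y K : R) : 0 <= K -> (forall d, 0 < d -> x <= y + d * K) -> x <= y.
Proof.
move=> K0 xy; apply/ler_addgt0Pr => d d0.
have K1 : 0 < K + 1 by lra.
apply: le_trans (xy _ (divr_gt0 d0 K1)) _; rewrite lerD2l.
by rewrite mulrAC ler_pdivrMr // ler_pM2l // lerDl.
Qed.

Fixpoint sqrt_bound (n : nat) : R :=
  if n is n'.+1 then 2^-1 * (1 + sqrt_bound n' ^+ 2) else 0.

Lemma sqrt_bound01 n : 0 <= sqrt_bound n <= 1.
Proof.
elim: n => [|n /andP[t0 t1]] /=; first by rewrite lexx ler01.
have : sqrt_bound n ^+ 2 <= 1 by rewrite expr_le1.
have := sqr_ge0 (sqrt_bound n); lra.
Qed.

Lemma sqrt_boundS n : sqrt_bound n <= sqrt_bound n.+1.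
Proof. by rewrite /=; have := sqr_ge0 (1 - sqrt_bound n); lra. Qed.

Fixpoint sqrt_seq A (n : nat) : H -> H :=
  if n is n'.+1 then (2^-1)%:C *: (A + (sqrt_seq A n' \o sqrt_seq A n')) else 0.

Lemma sqrt_seqE A n u :
  sqrt_seq A n.+1 u = (2^-1)%:C *: (A u + sqrt_seq A n (sqrt_seq A n u)).
Proof. by []. Qed.

(* With [1 - s] in place of the root this is the iteration
   [s = (A + s^2) / 2]; its increments are dominated by those of the same
   iteration started from the scalar 1. *)
Lemma one_sub_sqrt A : M A -> symmetric_op A -> (forall u, nrm (A u) <= nrm u) ->
  exists s, [/\ M s, symmetric_op s, forall u, nrm (s u) <= nrm u,
    forall u, s u + s u = A u + s (s u)
  & forall B, bounded_operator B -> (forall u, A (B u) = B (A u)) ->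
      forall u, s (B u) = B (s u)].
Proof.
move=> MA sA A1; pose Y := sqrt_seq A; pose t := sqrt_bound.
have MY n : M (Y n).
  elim: n => [|n IH]; first exact: M_zero.
  by apply: M_scale => //; apply: M_add => //; apply: M_comp.
have bY n : bounded_operator (Y n) by auto.
have Yt n u : nrm (Y n u) <= t n * nrm u.
  elim: n u => [|n IH] u; first by rewrite mul0r nrm0.
  rewrite [Y _ _]sqrt_seqE nrmZr ger0_norm ?invr_ge0 //= -mulrA ler_wpM2l ?invr_ge0 //.
  apply: le_trans (ler_nrmD _ _) _; rewrite mulrDl mul1r lerD //.
  apply: le_trans (IH _) _; rewrite expr2 -mulrA ler_wpM2l //.
  by case/andP: (sqrt_bound01 n).
have YS n u : nrm (Y n.+1 u - Y n u) <= (t n.+1 - t n) * nrm u.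
  elim: n u => [|n IH] u; first by rewrite !subr0; exact: Yt.
  (* With [a = Y n.+1] and [b = Y n], the identity [a^2 - b^2 = a (a - b) + (a - b) b] needs no
     commutation; the scalars [t] satisfy its exact analogue. *)
  have -> : Y n.+2 u - Y n.+1 u = (2^-1)%:C *:
      (Y n.+1 (Y n.+1 u - Y n u) + (Y n.+1 (Y n u) - Y n (Y n u))).
    rewrite [Y n.+2 u]sqrt_seqE [X in _ - X]sqrt_seqE -scalerBr; congr (_ *: _).
    by rewrite (opB (bY n.+1)) addrA subrK opprD addrACA subrr add0r.
  rewrite nrmZr ger0_norm ?invr_ge0 //.
  have -> : t n.+2 - t n.+1 = 2^-1 * (t n.+1 * (t n.+1 - t n) + (t n.+1 - t n) * t n).
    transitivity (2^-1 * (1 + t n.+1 ^+ 2) - 2^-1 * (1 + t n ^+ 2)); first by [].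
    by move: (t n.+1) (t n) => a b; field.
  rewrite -mulrA ler_wpM2l ?invr_ge0 //.
  apply: le_trans (ler_nrmD _ _) _; rewrite mulrDl; apply: lerD.
    apply: le_trans (Yt _ _) _; rewrite -mulrA ler_wpM2l //.
    by case/andP: (sqrt_bound01 n.+1).
  apply: le_trans (IH _) _; rewrite -mulrA ler_wpM2l //.
  by rewrite subr_ge0; exact: sqrt_boundS.
have [|||s Ms sY] := @operator_limit _ _ _ hM Y t 1 MY.
- exact: sqrt_boundS.
- by move=> n; case/andP: (sqrt_bound01 n).
- exact: YS.
have bs : bounded_operator s by auto.
have Y1 n u : nrm (Y n u) <= nrm u.
  apply: le_trans (Yt n u) _; rewrite -[leRHS]mul1r ler_wpM2r ?nrm_ge0 //.
  by case/andP: (sqrt_bound01 n).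
have s1 u : nrm (s u) <= nrm u.
  apply: (@le_small_mul _ _ (nrm u)) => [|d d0]; first exact: nrm_ge0.
  have [N /(_ _ (leqnn _)) sN] := sY _ d0.
  rewrite -(subrK (Y N u) (s u)) [leRHS]addrC; apply: le_trans (ler_nrmD _ _) _.
  by rewrite lerD.
have symY n : symmetric_op (Y n).
  elim: n => [|n IH] u v; first by rewrite inner0l inner0r.
  rewrite [Y n.+1 u]sqrt_seqE [Y n.+1 v]sqrt_seqE innerZl innerZr innerDl innerDr.
  by rewrite sA !IH; congr (_ * _); rewrite [RHS]conjc_real.
exists s; split=> //.
- apply: symmetric_rip => // u v.
  apply: (@le_small_mul _ _ (2 * (nrm u * nrm v))) => [|d d0].
    by rewrite mulr_ge0 // mulr_ge0 ?nrm_ge0.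
  have [N /(_ _ (leqnn _)) sN] := sY _ d0.
  have e1 := cauchy_schwarz (s u - Y N u) v.
  have e2 := cauchy_schwarz u (Y N v - s v).
  have f1 : nrm (s u - Y N u) * nrm v <= d * nrm u * nrm v by rewrite ler_wpM2r ?nrm_ge0.
  have f2 : nrm u * nrm (Y N v - s v) <= nrm u * (d * nrm v).
    by rewrite ler_wpM2l ?nrm_ge0 // nrmB.
  have : rip (Y N u) v = rip u (Y N v) by rewrite /rip symY.
  rewrite ripDl ripNl in e1; rewrite ripDr ripNr in e2.
  move: (rip _ _) (rip (Y N u) v) (rip (s u) v) (rip u (s v))
    (nrm (s u - Y N u)) (nrm (Y N v - s v)) e1 e2 f1 f2.
  move: (nrm u) (nrm v) => a b c1 c2 c3 c4 c5 c6; clear; lra.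
- move=> u; apply/eqP; rewrite -subr_eq0; apply/eqP/nrm_eq0.
  (* The factor 4: twice the error of [Y N.+1], plus the error of [Y N] at [u] and at [s u]. *)
  apply: (@small_mul_eq0 _ _ (4 * nrm u)) => [|d d0]; first exact: nrm_ge0.
  have [N sN] := sY _ d0.
  have sN0 := sN _ (leqnn _); have sN1 := sN _ (leqnSn _).
  have h1 : 2%:C * (2^-1)%:C = 1 :> R[i] by rewrite -rmorphM /= mulfV ?rmorph1 ?pnatr_eq0.
  have h2 v : 2%:C *: v = v + v by rewrite -[2]/(1 + 1) rmorphD rmorph1 scalerDl scale1r.
  have -> : s u + s u - (A u + s (s u)) = 2%:C *: (s u - Y N.+1 u) +
     (Y N (Y N u - s u) + (Y N (s u) - s (s u))).
    rewrite (opB (bY N)) [X in _ = _ + X]addrA subrK scalerBr [Y N.+1 u]sqrt_seqE.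
    by rewrite scalerA h1 scale1r h2 !opprD -!addrA addKr.
  apply: le_trans (ler_nrmD _ _) _; rewrite nrmZr ger0_norm //.
  have := ler_nrmD (Y N (Y N u - s u)) (Y N (s u) - s (s u)).
  have := Y1 N (Y N u - s u); rewrite [X in _ <= X]nrmB.
  have := sN0 u; have := sN1 u; have := sN0 (s u); rewrite [X in X <= _]nrmB.
  have : d * nrm (s u) <= d * nrm u by rewrite ler_pM2l.
  move: (nrm _) (nrm (s (s u) - Y N (s u))) => a0 a1.
  lra.
- move=> B bB AB u; have [C C0 BC] := op_norm_bound bB.
  have YB n v : Y n (B v) = B (Y n v).
    elim: n v => [|n IH] v; first by change (0 = B 0); rewrite (op0 bB).
    by rewrite ![Y n.+1 _]sqrt_seqE (opZ bB) (opD bB) AB -/(Y n) !IH.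
  apply/eqP; rewrite -subr_eq0; apply/eqP/nrm_eq0.
  apply: (@small_mul_eq0 _ _ (nrm (B u) + C * nrm u)) => [|d d0]; first exact: nrm_ge0.
  have [N /(_ _ (leqnn _)) sN] := sY _ d0.
  have -> : s (B u) - B (s u) = (s (B u) - Y N (B u)) + B (Y N u - s u).
    by rewrite (opB bB) YB addrA subrK.
  apply: le_trans (ler_nrmD _ _) _; rewrite mulrDr; apply: lerD => //.
  by apply: le_trans (BC _) _; rewrite mulrCA ler_wpM2l // nrmB.
Qed.

End SquareRoot.

Section SpectralProjections.
Variables (R : realType) (H : hilbertType R) (M : set (H -> H)).
Hypothesis hM : von_neumann_algebra M.
Implicit Types (u v w : H) (t : R) (A B a c d e f x y : H -> H).
Let Mb x : M x -> bounded_operator x := @M_bounded R H M hM x.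
Hint Resolve Mb : core.

(** With [c1 = c / K] a contraction and [A = 1 - c1^2], the solution of [2 s = A + s^2] satisfies
    [(1 - s)^2 = 1 - A = c1^2], so [K (1 - s)] is the absolute value of [c]. *)
Lemma operator_abs c : M c -> symmetric_op c -> exists d,
  [/\ M d, symmetric_op d, forall u, 0 <= rip (d u) u,
      forall u, d (d u) = c (c u) & forall u, d (c u) = c (d u)].
Proof.
move=> Mc sc; have bc := Mb Mc; have [C C0 cC] := op_norm_bound bc.
pose K := C + 1; have K0 : 0 < K by rewrite ltr_wpDl.
pose c1 := (K^-1)%:C *: c; have Mc1 : M c1 by exact: M_scale.
have c1E u : c1 u = (K^-1)%:C *: c u by [].
have bc1 : bounded_operator c1 by auto.
have sc1 : symmetric_op c1.
  by move=> u v; rewrite !c1E innerZl innerZr sc; congr (_ * _); rewrite [RHS]conjc_real.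
have c1n u : nrm (c1 u) <= nrm u.
  rewrite c1E nrmZr ger0_norm ?invr_ge0 ?(ltW K0) // mulrC ler_pdivrMr //.
  by apply: le_trans (cC u) _; rewrite mulrC ler_wpM2l ?nrm_ge0 // lerDl.
pose A : H -> H := id - (c1 \o c1); have AE u : A u = u - c1 (c1 u) by [].
have MA : M A by apply: M_sub => //; [exact: M_id|exact: M_comp].
have sA : symmetric_op A.
  by move=> u v; rewrite !AE innerDl innerDr innerNl innerNr !sc1.
have A1 u : nrm (A u) <= nrm u.
  rewrite -(@ler_pXn2r _ 2) ?nnegrE ?nrm_ge0 // AE nrmB2.
  have -> : rip u (c1 (c1 u)) = nrm (c1 u) ^+ 2 by rewrite /rip -sc1 -/(rip _ _) ripE.
  have : nrm (c1 (c1 u)) ^+ 2 <= nrm (c1 u) ^+ 2 by rewrite ler_pXn2r ?nnegrE ?nrm_ge0.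
  have := sqr_ge0 (nrm (c1 u)); lra.
have [s [Ms ss s1 sE scomm]] := one_sub_sqrt hM MA sA A1.
have bs : bounded_operator s by auto.
pose d : H -> H := K%:C *: (id - s); have dE u : d u = K%:C *: (u - s u) by [].
have Md : M d by apply: M_scale => //; apply: M_sub => //; exact: M_id.
have bd : bounded_operator d by auto.
exists d; split=> //.
- move=> u v; rewrite !dE innerZl innerZr innerDl innerDr innerNl innerNr ss.
  by congr (_ * _); rewrite [RHS]conjc_real.
- move=> u; rewrite dE ripZl mulr_ge0 ?(ltW K0) // ripDl ripNl ripE subr_ge0.
  apply: le_trans (cauchy_schwarz _ _) _.
  by rewrite expr2 ler_wpM2r ?nrm_ge0.
- move=> u; rewrite !dE (opZ bs) -scalerBr (opB bs).
  have -> : u - s u - (s u - s (s u)) = c1 (c1 u).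
    have := sE u; rewrite AE => E.
    rewrite opprB addrACA -opprD E opprD addrACA subrr addr0 opprB.
    by rewrite addrC subrK.
  have hK : K%:C * (K^-1)%:C = 1 by rewrite -rmorphM /= mulfV ?rmorph1 ?gt_eqF.
  by rewrite !c1E (opZ bc); do 2 rewrite (scalerA K%:C (K^-1)%:C) hK scale1r.
- move=> u; rewrite !dE (opZ bc) (opB bc) (scomm c bc) // => v.
  by rewrite !AE (opB bc) !c1E !(opZ bc) .
Qed.

(** [f] has the kernel of [|c| + c], twice the positive part of [c]. Since
    [(|c| + c) (|c| - c) = 0], one has [c = |c|] on the range of [f], while [c = - |c|] on its
    kernel. *)
Lemma spectral_split c : M c -> symmetric_op c -> exists f,
  [/\ projection_in M f, forall u, c u = 0 -> f u = 0,
      forall u, f u = u -> 0 <= rip (c u) u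
    & forall u, f u = 0 -> rip (c u) u <= 0].
Proof.
move=> Mc sc; have bc := Mb Mc.
have [d [Md sd d0 dd dc]] := operator_abs Mc sc; have bd := Mb Md.
pose b := d + c; have bE u : b u = d u + c u by [].
have Mbb : M b by exact: M_add.
have [|f [Pf f0 _]] := @kernel_support _ _ _ hM [set b]; first by move=> _ ->.
have bf u : b u = 0 -> f u = 0 by move=> bu; apply/f0 => _ ->.
have fb u : f u = 0 -> b u = 0 by move/f0; apply.
exists f; split=> // [u cu|u fu|u fu].
- apply: bf; rewrite bE cu addr0; apply: inner_eq0.
  by rewrite -sd dd cu op0 // inner0l.
- have fdc w : f (d w - c w) = 0.
    apply: bf; by rewrite bE (opB bd) (opB bc) dc dd addrA subrK subrr.
  suff /subr0_eq <- : d u - c u = 0 by [].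
  apply: inner_extl => w; rewrite inner0l innerDl innerNl sd sc -innerNr -innerDr.
  by rewrite -fu (projE hM Pf) fdc inner0r.
- have /eqP := fb _ fu; rewrite bE addrC addr_eq0 => /eqP ->.
  by rewrite ripNl oppr_le0.
Qed.

Definition subproj f e := projection_in M f /\ forall u, f (e u) = f u.

Lemma subprojP f e : projection_in M e -> projection_in M f ->
  (forall u, e u = 0 -> f u = 0) -> subproj f e.
Proof.
by move=> Pe Pf /(proj_eq0_comp hM Pe Pf)[fe _]; split=> // u; have := congr1 (@^~ u) fe.
Qed.

Lemma subproj_l f e u : projection_in M e -> subproj f e -> e (f u) = f u.
Proof.
move=> Pe [Pf fe]; apply: inner_extl => w.
by rewrite !(projE hM) // fe.
Qed.

(** [f] is the positive spectral projection of [y^* y - C^2 e]. Subtracting [C^2 e] makes this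
    operator vanish on the kernel of [e], which puts [f] below [e]; the vector [u0] shows that [f]
    is nonzero. *)
Lemma large_projection y e u0 (C : R) : M y -> projection_in M e ->
  (forall u, y (e u) = y u) -> 0 < C -> C * nrm u0 < nrm (y u0) -> exists f,
  [/\ subproj f e, f <> 0 & forall u, f u = u -> C * nrm u <= nrm (y u)].
Proof.
move=> My Pe ye C0 yu0; have by_ := Mb My; have be := proj_bounded hM Pe.
have Me := proj_M Pe.
pose c : H -> H := (adjoint y \o y) - (C ^+ 2)%:C *: e.
have cE u : c u = adjoint y (y u) - (C ^+ 2)%:C *: e u by [].
have Mc : M c.
  by apply: M_sub => //; [apply: M_comp => //; exact: M_adj|exact: M_scale].
have sc : symmetric_op c.
  move=> u v; rewrite !cE innerDl innerDr innerNl innerNr innerZl innerZr.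
  rewrite -adjointEr // -adjointE // (projE hM Pe).
  by congr (_ - _ * _); rewrite [RHS]conjc_real.
have ripc u : rip (c u) u = nrm (y u) ^+ 2 - C ^+ 2 * nrm (e u) ^+ 2.
  rewrite cE ripDl ripNl ripZl -!ripE /rip -adjointEr //.
  by rewrite (proj_inner hM Pe).
have [f [Pf cf f1 f0]] := spectral_split Mc sc.
have fe : subproj f e.
  apply: subprojP => // u eu; apply: cf.
  by rewrite cE eu -ye eu (op0 by_) (op0 (adjoint_bounded by_)) scaler0 subr0.
exists f; split=> // [f00|u fu].
  have := f0 u0; rewrite f00 => /(_ erefl); rewrite ripc leNgt => /negP; apply.
  rewrite subr_gt0 -exprMn ltr_pXn2r ?nnegrE ?nrm_ge0 ?mulr_ge0 ?(ltW C0) ?nrm_ge0 //.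
  by apply: le_lt_trans yu0; rewrite ler_pM2l // (proj_nrm hM Pe).
have := f1 _ fu; rewrite ripc subr_ge0 -exprMn.
have -> : e u = u by rewrite -fu subproj_l.
by rewrite ler_pXn2r ?nnegrE ?nrm_ge0 // mulr_ge0 ?nrm_ge0 // ltW.
Qed.

(** The quadratic form at [u + A u] reduces to [2 |A u|^2]. *)
Lemma symmetric_eq0 A : bounded_operator A -> symmetric_op A ->
  (forall u, rip (A u) u = 0) -> forall u, A u = 0.
Proof.
move=> bA sA A0 u; apply: nrm_eq0.
have := A0 (u + A u); rewrite (opD bA) ripDl !ripDr !A0 add0r addr0.
have -> : rip (A (A u)) u = rip (A u) (A u) by rewrite /rip sA.
by rewrite ripE => /eqP; rewrite -mulr2n mulrn_eq0 /= sqrf_eq0 => /eqP.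
Qed.

(** The inclusion of [e M e] in the multiples of [e], a form that yields scalars directly.
    [split_projection] links it to the absence of proper subprojections; [e = 0] is allowed. *)
Definition minimal e := forall m, M m -> exists l : R[i], forall u, e (m (e u)) = l *: e u.

Lemma split_projection e : projection_in M e -> ~ minimal e -> exists f,
  [/\ subproj f e, f <> 0 & f <> e].
Proof.
move=> Pe; apply: contra_notP => /forallNP nf.
have nosplit f : subproj f e -> f = 0 \/ f = e.
  move=> fe; have [->|f0] := pselect (f = 0); [by left|right].
  by apply: contrapT => f1; apply: (nf f).
have Me := proj_M Pe; have be := proj_bounded hM Pe.
have sym_scalar a : M a -> symmetric_op a -> (forall u, a (e u) = a u) ->
    exists t, forall u, a u = t%:C *: e u.
  move=> Ma sa ae; have ba := Mb Ma.
  pose c t : H -> H := a - t%:C *: e; have cE t u : c t u = a u - t%:C *: e u by [].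
  have Mc t : M (c t) by apply: M_sub => //; exact: M_scale.
  have sc t : symmetric_op (c t).
    move=> u v; rewrite !cE innerDl innerDr innerNl innerNr innerZl innerZr.
    by rewrite sa (projE hM Pe); congr (_ - _ * _); rewrite [RHS]conjc_real.
  have ripc t u : e u = u -> rip (c t u) u = rip (a u) u - t * nrm u ^+ 2.
    by move=> eu; rewrite cE ripDl ripNl ripZl eu ripE.
  (* If the quotients of [rip (a u) u] by [|u|^2] differed at two vectors of the range of [e], the
     spectral projection of [a] above their midpoint [t] would be neither 0, because of [v], nor
     [e], because of [u]. *)
  have le_aux u v : e u = u -> e v = v ->
      rip (a v) v * nrm u ^+ 2 <= rip (a u) u * nrm v ^+ 2.
    move=> eu ev; rewrite leNgt; apply/negP => lt.
    have nz w : nrm w ^+ 2 = 0 -> w = 0 by move=> /eqP; rewrite sqrf_eq0 => /eqP/nrm_eq0.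
    have u2 : 0 < nrm u ^+ 2.
      rewrite lt_neqAle sqr_ge0 andbT eq_sym; apply/eqP => /nz u0.
      by move: lt; rewrite u0 op0 // rip0l nrm0 expr0n mulr0 mul0r ltxx.
    have v2 : 0 < nrm v ^+ 2.
      rewrite lt_neqAle sqr_ge0 andbT eq_sym; apply/eqP => /nz v0.
      by move: lt; rewrite v0 op0 // rip0l nrm0 expr0n mulr0 mul0r ltxx.
    pose al := rip (a u) u / nrm u ^+ 2; pose bt := rip (a v) v / nrm v ^+ 2.
    have albt : al < bt by rewrite /al /bt ltr_pdivrMr // mulrAC ltr_pdivlMr.
    have alE : rip (a u) u = al * nrm u ^+ 2 by rewrite /al divfK // gt_eqF.
    have btE : rip (a v) v = bt * nrm v ^+ 2 by rewrite /bt divfK // gt_eqF.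
    pose t := (al + bt) / 2.
    have [f [Pf cf f1 f0]] := spectral_split (Mc t) (sc t).
    have fe : subproj f e.
      apply: subprojP => // w ew; apply: cf.
      by rewrite cE ew -ae ew op0 // scaler0 subr0.
    have [f00|f1e] := nosplit _ fe.
      have := f0 v; rewrite f00 => /(_ erefl); rewrite ripc // btE -mulrBl leNgt => /negP; apply.
      by rewrite mulr_gt0 // subr_gt0 /t; lra.
    have := f1 u; rewrite f1e => /(_ eu); rewrite ripc // alE -mulrBl leNgt => /negP; apply.
    by rewrite pmulr_llt0 // subr_lt0 /t; lra.
  have [e0|/existsNP[u0 u0e]] := pselect (forall u, e u = 0).
    by exists 0 => u; rewrite e0 scaler0 -ae e0 op0.
  pose v := e u0; have ev : e v = v by exact: (proj_idem Pe).
  have v0 : nrm v ^+ 2 != 0 by rewrite sqrf_eq0; apply/eqP => /nrm_eq0.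
  pose t := rip (a v) v / nrm v ^+ 2; exists t.
  have c0 u : rip (c t u) u = 0.
    have ce w : c t (e w) = c t w by rewrite !cE (proj_idem Pe) ae.
    have -> : rip (c t u) u = rip (c t (e u)) (e u).
      by rewrite ce (ripC _ (e u)) /rip -sc ce.
    have eeu := proj_idem Pe u.
    rewrite ripc //; apply/eqP; rewrite subr_eq0 /t mulrAC; apply/eqP.
    apply/(mulIf v0); rewrite divfK //; apply/eqP.
    by rewrite eq_le !le_aux.
  by move=> u; apply/subr0_eq; rewrite -cE; exact: (symmetric_eq0 (Mb (Mc t)) (sc t)).
move=> m Mm; have bm := Mb Mm; have Mam := M_adj hM Mm; have bam := Mb Mam.
have sym_e h : symmetric_op h -> symmetric_op (e \o h \o e).
  by move=> sh u v /=; rewrite !(projE hM Pe) sh !(projE hM Pe).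
have conji : Num.conj 'i = - 'i :> R[i].
  by change ('i^*%C = - 'i :> R[i]); apply/eqP; rewrite eq_complex /= oppr0 !eqxx.
(* Self-adjoint parts, with [m = (h1 + 'i h2) / 2]. *)
pose h1 : H -> H := m + adjoint m; have h1E u : h1 u = m u + adjoint m u by [].
pose h2 : H -> H := 'i *: (adjoint m - m); have h2E u : h2 u = 'i *: (adjoint m u - m u) by [].
have sh1 : symmetric_op h1.
  by move=> u v; rewrite !h1E innerDl innerDr -adjointEr // adjointE // addrC.
have sh2 : symmetric_op h2.
  move=> u v; rewrite !h2E innerZl innerZr innerDl innerDr innerNl innerNr.
  rewrite -adjointEr // adjointE // conji mulNr -mulrN opprB; congr (_ * _).
have [||t1 e1] := sym_scalar (e \o h1 \o e) _ (sym_e _ sh1).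
- by apply: M_comp => //; apply: M_comp => //; exact: M_add.
- by move=> u /=; rewrite (proj_idem Pe).
have [||t2 e2] := sym_scalar (e \o h2 \o e) _ (sym_e _ sh2).
- by apply: M_comp => //; apply: M_comp => //; apply: M_scale => //; exact: M_sub.
- by move=> u /=; rewrite (proj_idem Pe).
exists (2^-1 * (t1%:C + 'i * t2%:C)) => u.
rewrite -scalerA scalerDl -scalerA -e1 -e2 /= h1E h2E (opZ be) (opD be) (opB be).
rewrite scalerA -expr2 sqr_i scaleN1r opprB addrACA subrr addr0.
by rewrite -mulr2n -[X in _ *: X]scaler_nat scalerA mulVf ?scale1r ?pnatr_eq0.
Qed.

End SpectralProjections.

(** * Choice and linear algebra *)

(** Dependent choice in which each term may depend on all earlier ones, as orthogonality to the
    earlier terms requires. *)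
Lemma seq_choice (T : Type) (P : seq T -> Prop) : P [::] ->
  (forall s, P s -> exists x, P (rcons s x)) ->
  exists v : nat -> T, forall n, P (mkseq v n).
Proof.
move=> P0 PS; have [x0 _] := PS _ P0.
have /choice[g gP] : forall s, exists x, P s -> P (rcons s x).
  by move=> s; have [/PS[x Px]|nP] := pselect (P s); [exists x|exists x0].
pose F n := iter n (fun s => rcons s (g s)) [::].
exists (fun n => g (F n)) => n.
suff -> : mkseq (fun n => g (F n)) n = F n by elim: n => [|n IH] //=; exact: gP.
by elim: n => [//|n IH]; rewrite mkseqS IH.
Qed.

(** The coefficient matrix has one row more than columns, so a nonzero row vector annihilates it. *)
Lemma dependent_family (K : fieldType) (V : lmodType K) n (b : 'I_n -> V) (x : 'I_n.+1 -> V) :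
  (forall i, exists c : 'I_n -> K, x i = \sum_j c j *: b j) ->
  exists c : 'I_n.+1 -> K, (exists i, c i != 0) /\ \sum_i c i *: x i = 0.
Proof.
move=> /choice[C xC]; pose A : 'M[K]_(n.+1, n) := \matrix_(i, j) C i j.
have : kermx A != 0.
  by rewrite kermx_eq0 /row_free neq_ltn ltnS rank_leq_col.
move=> /rowV0Pn[v /sub_kermxP vA v0].
exists (fun i => v 0 i); split.
  apply: contrapT => /forallNP v00; case/negP: v0; apply/eqP/rowP => i.
  by rewrite mxE; apply/eqP/negPn/negP; exact: v00.
transitivity (\sum_j (\sum_i v 0 i * C i j) *: b j).
  under [RHS]eq_bigr do rewrite scaler_suml.
  rewrite exchange_big /=; apply: eq_bigr => i _.
  by rewrite xC scaler_sumr; apply: eq_bigr => j _; rewrite scalerA.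
apply: big1 => j _; have /rowP/(_ j) := vA; rewrite !mxE.
by under eq_bigr do rewrite mxE; move=> ->; rewrite scale0r.
Qed.

Section SeparatingFunctional.
Variables (K : fieldType) (V : lmodType K).

Definition linear_subspace (W : set V) := W 0 /\ forall c a b, W a -> W b -> W (c *: a + b).

(** A maximal subspace [A] containing [W] and missing [y] is a complement of the line through [y];
    [phi] is the coordinate along [y]. *)
Lemma separating_functional (W : set V) (y : V) : linear_subspace W -> ~ W y ->
  exists phi : V -> K, [/\ forall c a b, phi (c *: a + b) = c * phi a + phi b,
    forall a, W a -> phi a = 0 & phi y = 1].
Proof.
move=> sW Wy.
pose P A := A = set0 \/ [/\ linear_subspace A, W `<=` A & ~ A y].
have [F FP Ftot|A [PA Amax]] := @Zorn_bigcup V P.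
  have [[X FX [x Xx]]|nF] := pselect (exists2 X, F X & X !=set0); last first.
    left; apply/seteqP; split=> // v [X FX Xv]; apply: nF.
    by exists X => //; exists v.
  have Fsub Z z : F Z -> Z z -> [/\ linear_subspace Z, W `<=` Z & ~ Z y].
    by move=> /FP[->|].
  right; have [[X0 _] WX _] := Fsub _ _ FX Xx.
  split.
  - split=> [|c a b [Y FY Ya] [Z FZ Zb]]; first by exists X.
    have [[_ Ylin] _ _] := Fsub _ _ FY Ya; have [[_ Zlin] _ _] := Fsub _ _ FZ Zb.
    have [YZ|ZY] := Ftot _ _ FY FZ.
      by exists Z => //; apply: Zlin => //; exact: YZ.
    by exists Y => //; apply: Ylin => //; exact: ZY.
  - by move=> a /WX Xa; exists X.
  - by move=> [Y FY Yy]; have [_ _] := Fsub _ _ FY Yy; apply.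
have {PA} [[A0 Alin] WA Ay] : [/\ linear_subspace A, W `<=` A & ~ A y].
  case: PA => // AE; exfalso; apply: (Amax W); last by right; split.
  have [W0 _] := sW; rewrite AE; by split=> // /(_ _ W0).
have AB c a b : A a -> A b -> A (a - c *: b).
  by move=> Aa Ab; rewrite addrC -scaleNr; exact: Alin.
have Aspan v : exists c, A (v - c *: y).
  have [Av|Av] := pselect (A v); first by exists 0; rewrite scale0r subr0.
  (* [B] is spanned by [A] and [v]. By maximality it contains [y], with a nonzero coefficient at [v]
     because [A] misses [y]. *)
  pose B := [set b | exists c, A (b - c *: v)].
  have [c Bc] : B y.
    apply: contrapT => By; apply: (Amax B); last first.
      right; split=> //; last by move=> a /WA Aa; exists 0; rewrite scale0r subr0.
      split=> [|c a b [c1 Aa] [c2 Ab]]; first by exists 0; rewrite scale0r subr0.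
      exists (c * c1 + c2); have := Alin c _ _ Aa Ab.
      by rewrite scalerBr scalerA addrACA -opprD -scalerDl.
    split=> [a Aa|BA]; first by exists 0; rewrite scale0r subr0.
    by apply: Av; apply: BA; exists 1; rewrite scale1r subrr.
  exists c^-1; have c0 : c != 0.
    by apply: contra_notN Ay => /eqP c0; move: Bc; rewrite c0 scale0r subr0.
  have := AB c^-1 _ _ A0 Bc.
  by rewrite sub0r scalerBr scalerA mulVf // scale1r opprB.
have /choice[phi phiP] := Aspan.
have phiE v c : A (v - c *: y) -> phi v = c.
  move=> Avc; apply/eqP; rewrite -subr_eq0; apply: contra_notT Ay => d0.
  have := AB 1 _ _ Avc (phiP v).
  rewrite scale1r opprB addrC addrA subrK -scalerBl => Ad.
  have := Alin (phi v - c)^-1 _ _ Ad A0.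
  by rewrite addr0 scalerA mulVf // scale1r.
exists phi; split=> [c a b|a Wa|].
- apply: phiE; have := Alin c _ _ (phiP a) (phiP b).
  by rewrite scalerBr scalerA addrACA -opprD -scalerDl.
- by apply: phiE; rewrite scale0r subr0; exact: WA.
- by apply: phiE; rewrite scale1r subrr.
Qed.

End SeparatingFunctional.

(** * Orthonormal families over a minimal projection *)

Section Corners.
Variables (R : realType) (H : hilbertType R) (M : set (H -> H)).
Hypothesis hM : von_neumann_algebra M.
Implicit Types (u v w : H) (t : R) (A B a b c d e f r x y : H -> H).
Let Mb x : M x -> bounded_operator x := @M_bounded R H M hM x.
Hint Resolve Mb : core.

(** For projections this is [r M f], in a form where membership is tested on vectors; see
    [compression_corner]. *)
Definition corner r f := [set a | M a /\ forall u, r (a u) = a u /\ a (f u) = a u].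

Section MinimalProjection.
Variables (f r : H -> H).
Hypotheses (Pf : projection_in M f) (minf : minimal M f) (f0 : f <> 0).
Hypothesis Pr : projection_in M r.

Lemma corner_adjoint_l a u : corner r f a -> f (adjoint a u) = adjoint a u.
Proof.
move=> [Ma aP]; apply: inner_extr => w.
by rewrite -(projE hM Pf) -!adjointE; auto; rewrite (aP w).2.
Qed.

(** [a^* b] lies in [f M f]. The scalar serves as an inner product on [r M f]. *)
Lemma corner_scalar a b : corner r f a -> corner r f b ->
  exists l : R[i], forall u, adjoint a (b u) = l *: f u.
Proof.
move=> Xa Xb; have [Ma _] := Xa; have [Mb' bP] := Xb.
have [|l lP] := minf (m := adjoint a \o b).
  by apply: M_comp => //; exact: M_adj.
by exists l => u; rewrite -lP /= (bP u).2 corner_adjoint_l.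
Qed.

Lemma minimal_vector : exists2 u, f u = u & u <> 0.
Proof.
have /existsNP[u fu] : ~ forall u, f u = 0 by move=> E; apply: f0; apply/funext.
by exists (f u) => //; exact: (proj_idem Pf).
Qed.

(** Orthonormality for this inner product: partial isometries with common initial projection [f] and
    orthogonal ranges below [r]. *)
Definition orthonormal_seq (s : seq (H -> H)) :=
  (forall i, (i < size s)%N -> corner r f (nth 0 s i)) /\
  forall i j, (i < size s)%N -> (j < size s)%N ->
    forall u, adjoint (nth 0 s i) (nth 0 s j u) = (i == j)%:R *: f u.

(** A Fourier expansion. For orthonormal [s] and [a] in the corner, each [v_i^* a] is a multiple of
    [f], so this is membership in the linear span. *)
Definition corner_span (s : seq (H -> H)) a :=
  forall u, a u = \sum_(i < size s) nth 0 s i (adjoint (nth 0 s i) (a u)).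

Lemma corner_normalize a : corner r f a -> a <> 0 ->
  exists2 k : R, k != 0 & forall u, adjoint (k%:C *: a) ((k%:C *: a) u) = f u.
Proof.
move=> Xa a0; have [Ma aP] := Xa; have ba := Mb Ma.
have [l lP] := corner_scalar Xa Xa.
have [u fu u0] := minimal_vector.
have lu : `|a u| ^+ 2 = l * `|u| ^+ 2.
  by rewrite -!innerE adjointEr // lP fu innerZl.
have n0 : nrm u != 0 by apply/eqP => /nrm_eq0.
have lE : l = ((nrm (a u) / nrm u) ^+ 2)%:C.
  have nC0 : (nrm u)%:C ^+ 2 != 0.
    by rewrite -rmorphXn; apply/eqP => /complexI/eqP; rewrite sqrf_eq0 (negbTE n0).
  apply: (mulIf nC0); rewrite -normE -lu !normE -!rmorphXn -rmorphM /=.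
  by congr (_%:C); rewrite exprMn exprVn divfK // sqrf_eq0.
pose k := nrm (a u) / nrm u.
have k0 : k != 0.
  apply/eqP => k0; apply: a0; apply/funext => v; apply: inner_eq0.
  rewrite adjointEr // lP lE -/k k0 expr0n.
  by change (inner H (0%:C *: f v) v = 0); rewrite innerZl mul0r.
exists k^-1; first by rewrite invr_eq0.
move=> v; rewrite adjointZ //.
change ((Num.conj (k^-1)%:C) *: adjoint a ((k^-1)%:C *: a v) = f v).
rewrite (opZ (adjoint_bounded ba)) lP lE -/k !scalerA.
have -> : Num.conj (k^-1)%:C = (k^-1)%:C by exact: conjc_real.
by rewrite -!rmorphM /= expr2 mulKf // mulVf // rmorph1 scale1r.
Qed.

Lemma corner_lin (l : R[i]) a b : corner r f a -> corner r f b -> corner r f (l *: a + b).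
Proof.
move=> [Ma aP] [Mb' bP]; split; first exact: M_lin.
move=> u; change (r (l *: a u + b u) = l *: a u + b u /\ l *: a (f u) + b (f u) = l *: a u + b u).
by rewrite (opP (proj_bounded hM Pr)) (aP u).1 (bP u).1 (aP u).2 (bP u).2.
Qed.

Lemma corner0 : corner r f 0.
Proof.
split; first exact: M_zero.
by move=> u; change (r 0 = 0 /\ 0 = 0 :> H); rewrite (op0 (proj_bounded hM Pr)).
Qed.

Lemma corner_scale (l : R[i]) a : corner r f a -> corner r f (l *: a).
Proof. by move=> Xa; rewrite -[_ *: _]addr0; apply: corner_lin => //; exact: corner0. Qed.

Lemma corner_comp a b : corner r f a -> M b -> (forall u, f (b (f u)) = b u) -> corner r f (a \o b).
Proof.
move=> [Ma aP] Mb' bP; split; first exact: M_comp.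
move=> u /=; rewrite (aP _).1; split=> //.
by rewrite -(bP (f u)) -[in RHS](bP u) (proj_idem Pf).
Qed.

(** One Gram-Schmidt step: [a] minus its expansion is nonzero, and is normalised. *)
Lemma orthonormal_extend s a : orthonormal_seq s -> corner r f a -> ~ corner_span s a ->
  exists x, orthonormal_seq (rcons s x).
Proof.
move=> [sX so] Xa nsp; have [Ma aP] := Xa; have ba := Mb Ma.
pose v i := nth 0 s i.
have Xv i : (i < size s)%N -> corner r f (v i) by exact: sX.
have bv i : (i < size s)%N -> bounded_operator (v i) by move=> /Xv[/Mb].
pose p := \sum_(i < size s) (v i \o (adjoint (v i) \o a)).
have pE u : p u = \sum_(i < size s) v i (adjoint (v i) (a u)) by rewrite /p fct_sumE.
have Xp : corner r f p.
  rewrite /p; apply: (big_ind (corner r f)) => [|x y Xx Xy|i _]; first exact: corner0.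
    by rewrite -[x]scale1r; exact: corner_lin.
  have [Mv _] := Xv _ (ltn_ord i).
  apply: corner_comp; first exact: Xv.
    by apply: M_comp => //; exact: M_adj.
  by move=> u /=; rewrite (aP u).2 corner_adjoint_l //; exact: Xv.
pose w := a - p; have wE u : w u = a u - p u by [].
have Xw : corner r f w by rewrite /w addrC -scaleN1r; exact: corner_lin.
have w0 : w <> 0.
  move=> w0; apply: nsp => u; apply/eqP; rewrite -subr_eq0 -[X in _ - X]pE -wE w0; exact: eqxx.
have vw i u : (i < size s)%N -> adjoint (v i) (w u) = 0.
  move=> ilt; have bav := adjoint_bounded (bv _ ilt).
  rewrite wE (opB bav) pE (op_sum bav) (bigD1 (Ordinal ilt)) //= so // eqxx scale1r.
  rewrite corner_adjoint_l ?big1 ?addr0 ?subrr //; last exact: Xv.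
  move=> j ji; rewrite so // (_ : (i == j) = false) ?scale0r //.
  by apply: contraNF ji => /eqP ij; apply/eqP/val_inj.
have [k k0 kw] := corner_normalize Xw w0.
have Xx : corner r f (k%:C *: w) by exact: corner_scale.
have [Mx _] := Xx; have bx := Mb Mx.
exists (k%:C *: w); split=> [i|i j]; rewrite size_rcons ltnS.
  rewrite leq_eqVlt nth_rcons => /orP[/eqP ->|ilt]; first by rewrite ltnn eqxx.
  by rewrite ilt; exact: Xv.
have vx l u : (l < size s)%N -> adjoint (v l) ((k%:C *: w) u) = 0.
  move=> lls; change (adjoint (v l) (k%:C *: w u) = 0).
  by rewrite (opZ (adjoint_bounded (bv _ lls))) vw // scaler0.
rewrite ltnS (leq_eqVlt i) (leq_eqVlt j) !nth_rcons => /orP[/eqP ->|ilt] /orP[/eqP ->|jlt] u.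
- by rewrite !ltnn !eqxx scale1r.
- rewrite ltnn eqxx jlt gtn_eqF // scale0r; apply: inner_extl => z.
  by rewrite -(adjointEr bx) (adjointE (bv _ jlt)) vx // inner0r inner0l.
- by rewrite ltnn eqxx ilt ltn_eqF // scale0r vx.
- by rewrite ilt jlt so.
Qed.

(** Gram-Schmidt either meets a spanning family or never stops. The prescribed start [s0] serves to
    begin a sequence with [f] itself. *)
Lemma corner_basis_or_sequence s0 : orthonormal_seq s0 ->
  (exists s, orthonormal_seq s /\ forall a, corner r f a -> corner_span s a) \/
  (exists x : nat -> H -> H, [/\ forall i, corner r f (x i),
     forall i j u, adjoint (x i) (x j u) = (i == j)%:R *: f u
   & forall i, (i < size s0)%N -> x i = nth 0 s0 i]).
Proof.
move=> os0; have [|nbasis] := pselect (exists s,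
    orthonormal_seq s /\ forall a, corner r f a -> corner_span s a); first by left.
right; have [||v vP] := @seq_choice _ (fun s => orthonormal_seq (s0 ++ s)).
- by rewrite cats0.
- move=> s os.
  have /existsNP[a /not_implyP[Xa asp]] :
      ~ forall a, corner r f a -> corner_span (s0 ++ s) a.
    by move=> sp; apply: nbasis; exists (s0 ++ s).
  by have [x] := orthonormal_extend os Xa asp; rewrite rcons_cat; exists x.
pose x i := if (i < size s0)%N then nth 0 s0 i else v (i - size s0)%N.
have xE i n : (i < size s0 + n)%N -> nth 0 (s0 ++ mkseq v n) i = x i.
  move=> ilt; rewrite nth_cat /x; case: ltnP => // ge.
  by rewrite nth_mkseq // ltn_subLR // addnC.
have szE n : size (s0 ++ mkseq v n) = (size s0 + n)%N by rewrite size_cat size_mkseq.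
have lt i j : (i < size s0 + (maxn i j).+1)%N.
  by rewrite addnS ltnS; apply: leq_trans (leq_maxl i j) (leq_addl _ _).
exists x; split=> [i|i j u|i ilt]; last by rewrite /x ilt.
  have [/(_ i) + _] := vP i.+1; rewrite szE xE; last by rewrite addnS ltnS leq_addl.
  by apply; rewrite addnS ltnS leq_addl.
have [_ /(_ i j)] := vP (maxn i j).+1; rewrite szE !xE ?lt //; last by rewrite maxnC lt.
by apply; rewrite // maxnC lt.
Qed.

End MinimalProjection.

(** Composing a linear relation with [D k] isolates its [k]-th term, so the [x i] are independent.
    [D] will be the adjoints of an orthonormal sequence, or a sequence of orthogonal projections. *)
Lemma not_finite_dimensional (S : set (H -> H)) (x D : nat -> H -> H) :
  (forall i, S (x i)) -> (forall i, bounded_operator (D i)) ->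
  (forall i j, i != j -> D i \o x j = 0) -> (forall i, D i \o x i <> 0) ->
  ~ finite_dimensional S.
Proof.
move=> Sx bD D0 D1 [n [b [_ span]]].
have [i|c [[k ck] c0]] := @dependent_family _ _ n b (fun i => x i); first exact: span.
have := congr1 (fun y => D k \o y) c0.
rewrite (op_comp_sum (bD k)) (bigD1 k) //= big1 => [|i ik].
  rewrite addr0 (op_compZ (bD k)) (op_comp0 (bD k)) => /eqP.
  by rewrite scaler_eq0 (negbTE ck) /= => /eqP; exact: D1.
by rewrite (op_compZ (bD k)) D0 ?scaler0 // eq_sym.
Qed.

End Corners.

(** * The gliding hump *)

Section Subprojections.
Variables (R : realType) (H : hilbertType R) (M : set (H -> H)).
Hypothesis hM : von_neumann_algebra M.
Implicit Types (u v w : H) (A B a b c d e f g p q r x y z : H -> H).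
Let Mb x : M x -> bounded_operator x := @M_bounded R H M hM x.
Hint Resolve Mb : core.

Lemma compression_corner q p : projection_in M q -> projection_in M p ->
  compression q M p = corner M q p.
Proof.
move=> Pq Pp; apply/seteqP; split=> [_ [m Mm <-]|x [Mx xP]].
  split; first by apply: M_comp => //; [apply: M_comp => //; exact: proj_M Pq|exact: proj_M Pp].
  by move=> u /=; rewrite (proj_idem Pq) (proj_idem Pp).
by exists x => //; apply/funext => u /=; rewrite (xP _).1 (xP _).2.
Qed.

Lemma subproj_sub e f : projection_in M e -> subproj M f e ->
  subproj M (e - f) e /\ (forall u, f (e u - f u) = 0).
Proof.
move=> Pe fe; have [Pf fE] := fe; have be := proj_bounded hM Pe; have bf := proj_bounded hM Pf.
have [Me ae _] := Pe; have [Mf af _] := Pf.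
split; last by move=> u; rewrite (opB bf) fE (proj_idem Pf) subrr.
split; last first.
  move=> u; change (e (e u) - f (e u) = e u - f u).
  by rewrite (proj_idem Pe) fE.
split; first exact: M_sub.
  by rewrite (adjointB_M hM) // ae af.
apply/funext => u; change (e (e u - f u) - f (e u - f u) = e u - f u).
by rewrite (opB be) (opB bf) (proj_idem Pe) (subproj_l hM _ Pe fe) fE (proj_idem Pf) subrr subr0.
Qed.

Lemma subproj_trans e f g : subproj M g f -> subproj M f e -> subproj M g e.
Proof. by move=> [Pg gf] [Pf fe]; split=> // u; rewrite -gf fe gf. Qed.

Lemma subproj_refl e : projection_in M e -> subproj M e e.
Proof. by move=> Pe; split=> // u; rewrite (proj_idem Pe). Qed.

(** Exhaustion: [P] is what the remainder retains, [Q n] what the [n]-th piece achieves. Used for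
    unboundedness with humps, and for infinite dimension with nonzero pieces. *)
Lemma orthogonal_sequence (P : (H -> H) -> Prop) (Q : nat -> (H -> H) -> Prop) p :
  projection_in M p -> P p ->
  (forall n e, subproj M e p -> P e -> exists f, [/\ subproj M f e, Q n f & P (e - f)]) ->
  exists f : nat -> H -> H,
    (forall n, subproj M (f n) p /\ Q n (f n)) /\
    forall i j, i != j -> forall u, f i (f j u) = 0.
Proof.
move=> Pp PP step.
pose good (s : seq (H -> H)) :=
  [/\ forall i, (i < size s)%N -> subproj M (nth 0 s i) p /\ Q i (nth 0 s i),
      forall i j, (i < j < size s)%N -> forall u, nth 0 s i (nth 0 s j u) = 0
    & exists e, [/\ subproj M e p, P e &
        forall i, (i < size s)%N -> forall u, nth 0 s i (e u) = 0]].
have [||f fP] := @seq_choice _ good.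
- split=> // [i j /andP[]|] //; exists p; split=> //; exact: subproj_refl.
- move=> s [s1 s2 [e [ep Pe se]]]; have [f [fe Qf Pef]] := step (size s) _ ep Pe.
  have [Pre _] := ep; exists f; split=> [i|i j|].
  + rewrite size_rcons ltnS leq_eqVlt nth_rcons => /orP[/eqP ->|ilt].
      by rewrite ltnn eqxx; split=> //; exact: subproj_trans fe ep.
    by rewrite ilt; exact: s1.
  + rewrite size_rcons ltnS (leq_eqVlt j) !nth_rcons => /andP[ij /orP[/eqP jE|jlt]] u.
      by rewrite jE ltnn eqxx -jE ij -(subproj_l hM u Pre fe) se // -jE.
    by rewrite (ltn_trans ij jlt) jlt s2 // ij.
  + have [efe fef] := subproj_sub Pre fe.
    exists (e - f); split=> // [|i]; first exact: subproj_trans efe ep.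
    rewrite size_rcons ltnS leq_eqVlt nth_rcons => /orP[/eqP ->|ilt] u.
      by rewrite ltnn eqxx; exact: fef.
    rewrite ilt -(subproj_l hM u Pre efe); exact: se.
have f1 n : subproj M (f n) p /\ Q n (f n).
  have [/(_ n) + _ _] := fP n.+1; rewrite size_mkseq nth_mkseq //; exact.
have f2 i j u : (i < j)%N -> f i (f j u) = 0.
  move=> ij; have [_ /(_ i j) + _] := fP j.+1.
  rewrite size_mkseq !nth_mkseq ?ij ?ltnSn //; last exact: ltnW.
  by move=> /(_ isT u).
exists f; split=> // i j ij u; have [lt|gt|/eqP] := ltngtP i j; last by rewrite (negbTE ij).
  exact: f2.
have [[Pi _] _] := f1 i; have [[Pj _] _] := f1 j.
apply: inner_extl => w.
by rewrite (projE hM Pi) (projE hM Pj) f2 // inner0l inner0r.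
Qed.

Lemma finite_dimensional_fin (S : set (H -> H)) (I : finType) (b : I -> H -> H) :
  (forall i, S (b i)) ->
  (forall x, S x -> exists c : I -> R[i], x = \sum_i c i *: b i) ->
  finite_dimensional S.
Proof.
move=> Sb span; exists #|I|, (fun i => b (enum_val i)); split=> [i|x Sx]; first exact: Sb.
have [c ->] := span _ Sx; exists (fun i => c (enum_val i)).
by rewrite -(big_enum_val (fun i => c i *: b i)); apply: eq_bigl.
Qed.

End Subprojections.

(** * Restricting a decomposable transformation to subprojections *)

Section Decomposable.
Variables (R : realType) (H : hilbertType R) (M : set (H -> H)).
Hypothesis hM : von_neumann_algebra M.
Implicit Types (u v w : H) (A B a b c d e f g r x y z : H -> H).
Let Mb x : M x -> bounded_operator x := @M_bounded R H M hM x.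
Hint Resolve Mb : core.
Variables (p q : H -> H).
Hypotheses (Pp : projection_in M p) (Pq : projection_in M q).
Local Notation X := (corner M q p).
Variable T : (H -> H) -> H -> H.
Hypotheses (TM : forall x, X x -> M (T x))
  (Tlin : forall (c : R[i]) x y, X x -> X y -> T (c *: x + y) = c *: T x + T y)
  (Tker : forall x u, X x -> x u = 0 -> T x u = 0).

Lemma transf0 : T 0 = 0.
Proof.
have X0 := corner0 hM p Pq.
have := Tlin 1 X0 X0; rewrite !scale1r addr0 => E.
by apply: (addIr (T 0)); rewrite -E add0r.
Qed.

Lemma transfZ (c : R[i]) x : X x -> T (c *: x) = c *: T x.
Proof.
by move=> Xx; rewrite -[_ *: x]addr0 Tlin // ?transf0 ?addr0 //; exact: corner0.
Qed.

Lemma transfD x y : X x -> X y -> T (x + y) = T x + T y.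
Proof. by move=> Xx Xy; rewrite -[x]scale1r Tlin // !scale1r. Qed.

Lemma transfB x y : X x -> X y -> T (x - y) = T x - T y.
Proof.
by move=> Xx Xy; rewrite addrC -scaleN1r Tlin // scaleN1r addrC.
Qed.

Lemma transf_sum n (c : 'I_n -> R[i]) (x : 'I_n -> H -> H) : (forall i, X (x i)) ->
  T (\sum_i c i *: x i) = \sum_i c i *: T (x i).
Proof.
move=> Xx.
have [] : X (\sum_i c i *: x i) /\ T (\sum_i c i *: x i) = \sum_i c i *: T (x i); last by [].
apply: (big_rec2 (fun a b => X a /\ T a = b)) => [|i a b _ [Xb <-]].
  by split; [exact: corner0|exact: transf0].
by split; [exact: corner_lin|rewrite Tlin].
Qed.

Lemma transf_congr x u v : X x -> x u = x v -> T x u = T x v.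
Proof.
move=> Xx xuv; have bx : bounded_operator x by case: Xx => /Mb.
apply/eqP; rewrite -subr_eq0 -(opB (Mb (TM Xx))); apply/eqP/Tker => //.
by rewrite (opB bx) xuv subrr.
Qed.

Lemma corner_subproj x f : X x -> subproj M f p -> X (x \o f).
Proof.
move=> [Mx xP] [Pf fp]; split; first by apply: M_comp => //; exact: proj_M Pf.
by move=> u /=; rewrite (xP _).1 fp.
Qed.

(** In [x = x f + x (p - f)] the second summand vanishes on the range of [f], hence so does its
    image; and [T (x f)] takes equal values at [u] and [f u]. *)
Lemma transf_subproj x f u : X x -> subproj M f p -> T (x \o f) u = T x (f u).
Proof.
move=> Xx fp; have [Pf fE] := fp; have [pfp fpf] := subproj_sub hM Pp fp.
have Xxf := corner_subproj Xx fp; have Xxpf := corner_subproj Xx pfp.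
have bx : bounded_operator x by case: Xx => /Mb.
have xE : x = (x \o f) + (x \o (p - f)).
  apply/funext => v; change (x v = x (f v) + x (p v - f v)).
  by case: Xx => _ /(_ v)[_ xp]; rewrite (opB bx) addrC subrK.
rewrite (transf_congr (v := f u) Xxf) /=; last by rewrite (proj_idem Pf).
rewrite [in RHS]xE transfD //.
change (T (x \o f) (f u) = T (x \o f) (f u) + T (x \o (p - f)) (f u)).
rewrite [X in _ + X]Tker ?addr0 //=.
change (x (p (f u) - f (f u)) = 0).
by rewrite (subproj_l hM u Pp fp) (proj_idem Pf) subrr op0.
Qed.

(** Unboundedness on [q M e]. The two parameters let the smallness of [x] and the size of [T x] be
    prescribed independently. *)
Definition unbounded_on e := forall (C eps : R), 0 < eps -> exists x,
  [/\ X x, forall u, x (e u) = x u, forall u, nrm (x u) <= eps * nrm u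
    & exists u, C * nrm u < nrm (T x u)].

Lemma unbounded_on_sub e f : subproj M f e -> unbounded_on f -> unbounded_on e.
Proof.
move=> [Pf fe] bf C eps e0; have [x [Xx xf xn xT]] := bf C eps e0.
by exists x; split=> // u; rewrite -xf fe xf.
Qed.

(** Otherwise [T x = T x f + T x (e - f)] would be bounded by the sum of two constants for all [x]
    in the smaller of two balls. *)
Lemma unbounded_on_split e f : subproj M e p -> subproj M f e ->
  unbounded_on e -> unbounded_on f \/ unbounded_on (e - f).
Proof.
move=> ep fe be; have [Pe _] := ep; have [efe fef] := subproj_sub hM Pe fe.
have [|nbf] := pselect (unbounded_on f); first by left.
have [|nbef] := pselect (unbounded_on (e - f)); first by right.
exfalso.
have get g : subproj M g e -> ~ unbounded_on g -> exists C eps : R, 0 < eps /\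
    forall x, X x -> (forall u, nrm (x u) <= eps * nrm u) -> forall u, nrm (T x (g u)) <= C * nrm u.
  move=> ge /existsNP[C /existsNP[eps /not_implyP[e0 nx]]]; exists C, eps; split=> // x Xx xn u.
  have gp := subproj_trans ge ep; have [Pg _] := ge.
  rewrite leNgt; apply/negP => lt; apply: nx; exists (x \o g); split.
  - exact: corner_subproj.
  - by move=> v /=; rewrite (proj_idem Pg).
  - move=> v /=; apply: le_trans (xn _) _.
    by rewrite ler_wpM2l ?(ltW e0) // (proj_nrm hM Pg).
  - by exists u; rewrite transf_subproj.
have [C1 [eps1 [e1 b1]]] := get _ fe nbf.
have [C2 [eps2 [e2 b2]]] := get _ efe nbef.
have [|x [Xx xe xn [u]]] := be (C1 + C2) (Num.min eps1 eps2).
  by rewrite lt_min e1 e2.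
rewrite ltNge => /negP; apply.
rewrite -(transf_congr (u := e u) Xx) //.
have -> : e u = f u + (e - f) u by change (e u = f u + (e u - f u)); rewrite addrC subrK.
rewrite (opD (Mb (TM Xx))); apply: le_trans (ler_nrmD _ _) _; rewrite mulrDl lerD //.
  apply: b1 => // v; apply: le_trans (xn v) _; apply: ler_wpM2r; first exact: nrm_ge0.
  by rewrite ge_min lexx.
apply: b2 => // v; apply: le_trans (xn v) _; apply: ler_wpM2r; first exact: nrm_ge0.
by rewrite ge_min lexx orbT.
Qed.

Definition hump n f := exists x,
  [/\ X x, forall u, x (f u) = x u, forall u, nrm (x u) <= 2^-1 ^+ n * nrm u
    & exists u, n%:R * nrm u < nrm (T x u)].

Lemma unbounded_hump n f : unbounded_on f -> hump n f.
Proof. by move=> bf; apply: bf; rewrite exprn_gt0 // invr_gt0. Qed.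

(* The sum of the humps converges in norm, and [T] would be unbounded at it. *)
Lemma no_hump_sequence (f : nat -> H -> H) :
  (forall n, subproj M (f n) p /\ hump n (f n)) ->
  (forall i j, i != j -> forall u, f i (f j u) = 0) -> False.
Proof.
move=> fP orth.
have /choice[x xP] : forall n, exists x, [/\ X x, forall u, x (f n u) = x u,
    forall u, nrm (x u) <= 2^-1 ^+ n * nrm u
    & exists u, n%:R * nrm u < nrm (T x u)] by move=> n; exact: (fP n).2.
(* [t n] is the partial sum of the geometric series bounding the humps. *)
pose Y n := \sum_(i < n) x i; pose t n : R := 2 - 2 * 2^-1 ^+ n.
have Mx n : M (x n) by have [[]] := xP n.
have bx n : bounded_operator (x n) by auto.
have YE n u : Y n u = \sum_(i < n) x i u by rewrite /Y fct_sumE.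
have XY n : X (Y n).
  apply: (big_ind X) => [|a b Xa Xb|i _]; first exact: corner0.
    by rewrite -[a]scale1r; exact: corner_lin.
  by case: (xP i).
have tS n : t n.+1 - t n = 2^-1 ^+ n by rewrite /t exprS; field.
have pos n : 0 <= 2^-1 ^+ n :> R by rewrite exprn_ge0 // invr_ge0.
have [||||Z MZ ZY] := @operator_limit _ _ _ hM Y t 2.
- by move=> n; case: (XY n).
- by move=> n; rewrite -subr_ge0 tS.
- by move=> n; rewrite /t; have := pos n; lra.
- by move=> n u; rewrite tS !YE big_ord_recr /= addrAC subrr add0r; case: (xP n).
have bZ := Mb MZ.
have XZ : X Z.
  split=> // u; split; apply/eqP; rewrite -subr_eq0; apply/eqP/nrm_eq0.
    apply: (@small_mul_eq0 _ _ (2 * nrm u)) => [|d d0]; first exact: nrm_ge0.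
    have [N /(_ _ (leqnn _) u) ZN] := ZY _ d0; have [_ /(_ u)[qY _]] := XY N.
    have -> : q (Z u) - Z u = q (Z u - Y N u) + (Y N u - Z u).
      by rewrite (opB (proj_bounded hM Pq)) qY addrA subrK.
    apply: le_trans (ler_nrmD _ _) _; rewrite (nrmB (Y N u)).
    have := proj_nrm hM Pq (Z u - Y N u); lra.
  apply: (@small_mul_eq0 _ _ (nrm (p u) + nrm u)) => [|d d0]; first exact: nrm_ge0.
  have [N /(_ _ (leqnn _)) ZN] := ZY _ d0; have [_ /(_ u)[_ Yp]] := XY N.
  have -> : Z (p u) - Z u = (Z (p u) - Y N (p u)) + (Y N u - Z u).
    by rewrite Yp addrA subrK.
  apply: le_trans (ler_nrmD _ _) _; rewrite mulrDr lerD // nrmB; exact: ZN.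
(* All other humps vanish on the range of [f n]. *)
have Zf n : x n = Z \o f n.
  have [_ xf _ _] := xP n.
  apply/funext => u /=; apply/eqP; rewrite eq_sym -subr_eq0; apply/eqP/nrm_eq0.
  apply: (@small_mul_eq0 _ _ (nrm (f n u))) => [|d d0]; first exact: nrm_ge0.
  have [N /(_ (maxn N n.+1) (leq_maxl _ _) (f n u))] := ZY _ d0.
  suff -> : Y (maxn N n.+1) (f n u) = x n u by [].
  rewrite YE (bigD1 (Ordinal (leq_maxr N n.+1))) //= xf big1 ?addr0 // => i ni.
  have [_ xfi _ _] := xP i; by rewrite -xfi orth ?op0.
have [K K0 TK] := op_norm_bound (Mb (TM XZ)).
pose n := (Num.truncn K).+1; have Kn : K < n%:R by exact: truncnS_gt.
have [[fp _] [_ _ _ [u]]] := (fP n, xP n).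
rewrite Zf transf_subproj // ltNge => /negP; apply.
apply: le_trans (TK _) _; apply: ler_pM => //; [exact: nrm_ge0|exact: ltW|].
by apply: (proj_nrm hM); case: fp.
Qed.

End Decomposable.

(** * Minimal projections and central supports *)

Section MinimalCase.
Variables (R : realType) (H : hilbertType R) (M : set (H -> H)).
Hypothesis hM : von_neumann_algebra M.
Implicit Types (u v w : H) (A B a b c d e f g r x y z : H -> H).
Let Mb x : M x -> bounded_operator x := @M_bounded R H M hM x.
Hint Resolve Mb : core.

Lemma inner_suml I (r : seq I) (F : I -> H) w :
  inner H (\sum_(i <- r) F i) w = \sum_(i <- r) inner H (F i) w.
Proof.
by apply: (big_morph (fun y : H => inner H y w)) => [a b|]; [exact: innerDl|exact: inner0l].
Qed.

Lemma inner_sumr I (r : seq I) (F : I -> H) w :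
  inner H w (\sum_(i <- r) F i) = \sum_(i <- r) inner H w (F i).
Proof.
by apply: (big_morph (fun y : H => inner H w y)) => [a b|]; [exact: innerDr|exact: inner0r].
Qed.

Lemma frame_symmetric (s : seq (H -> H)) u w :
  (forall i, (i < size s)%N -> bounded_operator (nth 0 s i)) ->
  inner H (\sum_(i < size s) nth 0 s i (adjoint (nth 0 s i) u)) w =
  inner H u (\sum_(i < size s) nth 0 s i (adjoint (nth 0 s i) w)).
Proof.
move=> bs; rewrite inner_suml inner_sumr; apply: eq_bigr => i _.
by rewrite (adjointE (bs _ (ltn_ord i))) -(adjointEr (bs _ (ltn_ord i))).
Qed.

Lemma partial_isometry_nrm (v f : H -> H) : bounded_operator v -> projection_in M f ->
  (forall u, adjoint v (v u) = f u) ->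
  (forall u, nrm (v u) <= nrm u) /\ forall u, nrm (adjoint v u) <= nrm u.
Proof.
move=> bv Pf vv.
have v1 u : nrm (v u) <= nrm u.
  apply: le_trans (proj_nrm hM Pf u).
  rewrite -(@ler_pXn2r _ 2) ?nnegrE ?nrm_ge0 // -!ripE /rip (adjointEr bv) vv.
  by rewrite (proj_inner hM Pf).
split=> // y.
have [E|n0] := eqVneq (nrm (adjoint v y)) 0; first by rewrite E nrm_ge0.
have n_gt0 : 0 < nrm (adjoint v y) by rewrite lt_neqAle eq_sym n0 nrm_ge0.
rewrite -(ler_pM2l n_gt0) -expr2 -ripE /rip -(adjointEr bv).
apply: le_trans (cauchy_schwarz _ _) _; rewrite mulrC.
by apply: ler_wpM2r; [exact: nrm_ge0|exact: v1].
Qed.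

Lemma central_comp z p : central_projection_in M z -> projection_in M p ->
  projection_in M (z \o p).
Proof.
move=> [Pz zc] Pp; have [Mz az zz] := Pz; have [Mp ap pp] := Pp.
have zp := zc _ Mp.
split; first exact: M_comp.
  by rewrite adjoint_comp; auto; rewrite az ap zp.
apply/funext => u /=; have := congr1 (@^~ (p u)) zp => /= <-.
by rewrite (proj_idem Pz) (proj_idem Pp).
Qed.

Section Corner.
Variables (p q f : H -> H).
Hypotheses (Pp : projection_in M p) (Pq : projection_in M q).
Hypotheses (fp : subproj M f p) (minf : minimal M f) (f0 : f <> 0).
Let Pf : projection_in M f. Proof. by case: fp. Qed.

(** [z] is the central support of [f], obtained from the common kernel of [f M]. Since [z p = S] is
    the sum of the [v_i v_i^*], every [z p m p] expands in the [v_i v_j^*], with scalar coefficients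
    by minimality of [f]. *)
Lemma finite_central_support (s : seq (H -> H)) : orthonormal_seq M f p s ->
  (forall a, corner M p f a -> corner_span s a) ->
  exists z, [/\ central_projection_in M z, forall u, z (f u) = f u
    & finite_dimensional (compression (z \o p) M p)].
Proof.
move=> [sX so] basis; have [Mf _ _] := Pf; have [Mp _ _] := Pp.
pose v i := nth 0 s i.
have Xv i : (i < size s)%N -> corner M p f (v i) by exact: sX.
have Mv i : (i < size s)%N -> M (v i) by move=> /Xv[].
have bv i : (i < size s)%N -> bounded_operator (v i) by move=> /Mv; auto.
have [|z [Pz z0 zc]] := @kernel_support _ _ _ hM [set f \o m | m in M].
  by move=> _ [m Mm <-]; exact: M_comp.
have {}zc m : M m -> z \o m = m \o z.
  apply: zc => _ n [k Mk <-] Mn; exists (k \o n) => //; exact: M_comp.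
have zcE m u : M m -> z (m u) = m (z u) by move=> /zc/(congr1 (@^~ u)).
have [fz zf] : f \o z = f /\ z \o f = f.
  apply: (proj_eq0_comp hM Pz Pf) => u /z0 zu; apply: (zu (f \o id)).
  by exists id => //; exact: M_id.
have zfE u : z (f u) = f u by have := congr1 (@^~ u) zf.
have zv i u : (i < size s)%N -> z (v i u) = v i u.
  by move=> /[dup]/Xv[_ /(_ u)[_ <-]] /Mv Mi; rewrite zcE // zfE.
pose S u := \sum_(i < size s) v i (adjoint (v i) u).
have zS u : z (S u) = S u.
  by rewrite /S (op_sum (proj_bounded hM Pz)); apply: eq_bigr => i _; rewrite zv.
have Ssym u w : inner H (S u) w = inner H u (S w) by exact: frame_symmetric.
have adjv_p i u : (i < size s)%N -> adjoint (v i) (p u) = adjoint (v i) u.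
  move=> ilt; apply: inner_extr => w; have bi := bv _ ilt; have [_ /(_ w)[pv _]] := Xv _ ilt.
  by rewrite -!adjointE // -[in RHS]pv (projE hM Pp).
have Sp u : S (p u) = S u.
  by apply: eq_bigr => i _; rewrite adjv_p.
have SE a u : corner M p f a -> S (a u) = a u by move=> Xa; rewrite [RHS](basis _ Xa).
(* Every [f m] annihilates [p u - S u], because [S] is symmetric and fixes the range of [p m^* f];
   so [z] annihilates it too. *)
have zpS u : z (p u) = S u.
  rewrite -zS; apply/eqP; rewrite -subr_eq0 -(opB (proj_bounded hM Pz)); apply/eqP.
  apply/z0 => _ [m Mm <-] /=; apply: inner_extl => w.
  have bm := Mb Mm; have Mam := M_adj hM Mm.
  rewrite inner0l (projE hM Pf) adjointE // innerDl innerNl (projE hM Pp) Ssym.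
  rewrite -Sp (SE (p \o adjoint m \o f)) /= ?subrr //.
  split; first by apply: (M_comp hM) => //; exact: M_comp.
  by move=> y /=; rewrite (proj_idem Pp) (proj_idem Pf).
have Cz : central_projection_in M z by split.
exists z; split=> //; pose n := size s.
pose b (ij : 'I_n * 'I_n) := v ij.1 \o adjoint (v ij.2).
have Pzp := central_comp Cz Pp.
apply: (@finite_dimensional_fin _ _ _ _ b) => [[i j]|_ [m Mm <-]].
  exists (v i \o adjoint (v j)).
    by apply: (M_comp hM); [exact: Mv|apply: (M_adj hM); exact: Mv].
  apply/funext => u /=; have [_ /(_ (adjoint (v j) u))[pv _]] := Xv _ (ltn_ord i).
  by rewrite /b /= adjv_p // pv zv.
have lP (ij : 'I_n * 'I_n) : exists l : R[i], forall u,
    f (adjoint (v ij.1) (m (v ij.2 (f u)))) = l *: f u.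
  have [|l lP] := minf (m := adjoint (v ij.1) \o m \o v ij.2); last by exists l.
  by apply: (M_comp hM); [apply: (M_comp hM) => //; apply: (M_adj hM)|]; exact: Mv.
have /choice[c cP] := lP; exists c; apply/funext => u /=.
rewrite fct_sumE.
have -> : z (p (m (p u))) = S (m (S u)).
  have Sz w : S (z w) = S w by rewrite -zpS -(zcE p w Mp) (proj_idem Pz) zpS.
  by rewrite zpS -(zpS u) -(zcE m (p u) Mm) Sz.
transitivity (\sum_i \sum_j (c (i, j) *: b (i, j)) u); last first.
  by rewrite pair_bigA; apply: eq_bigr => -[].
apply: eq_bigr => i _.
have bvi := bv _ (ltn_ord i); have bai := adjoint_bounded bvi; have bm := Mb Mm.
rewrite /S (op_sum bm) (op_sum bai) (op_sum bvi); apply: eq_bigr => j _.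
change (v i (adjoint (v i) (m (v j (adjoint (v j) u)))) = c (i, j) *: v i (adjoint (v j) u)).
have fadj k w : (k < size s)%N -> f (adjoint (v k) w) = adjoint (v k) w.
  by move=> /Xv Xk; exact: (corner_adjoint_l hM Pf w Xk).
by rewrite -(opZ bvi) -(fadj j u) // -(cP (i, j)) /= (fadj i).
Qed.

(** As [f] lies below [z] and [p], an infinite orthonormal sequence of [q M f] would be an
    independent one in [z q M p]. *)
Lemma finite_corner_basis z : central_projection_in M z -> (forall u, z (f u) = f u) ->
  finite_dimensional (compression (z \o q) M p) ->
  exists s, orthonormal_seq M f q s /\ forall a, corner M q f a -> corner_span s a.
Proof.
move=> Cz zf fd; have [Pz zc] := Cz.
have [||[x [Xx xo _]]] := @corner_basis_or_sequence _ _ _ hM f q Pf minf f0 Pq [::]; [by []|by []|].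
exfalso; apply: (@not_finite_dimensional _ _ (compression (z \o q) M p) x
  (fun i => adjoint (x i))) fd.
- move=> i; have [Mx xP] := Xx i; rewrite compression_corner //; last exact: central_comp.
  split=> // u; have [qx xf] := xP u; split=> /=.
    by rewrite qx -xf; have /= -> := congr1 (@^~ (f u)) (zc _ Mx); rewrite zf.
  by rewrite -[LHS](xP _).2 -[in RHS]xf; case: fp => _ ->.
- by move=> i; apply: adjoint_bounded; case: (Xx i); auto.
- by move=> i j ij; apply/funext => u /=; rewrite xo (negbTE ij) scale0r.
- move=> i E; apply: f0; apply/funext => u.
  by have /= := congr1 (@^~ u) E; rewrite xo eqxx scale1r.
Qed.

Section Transformation.
Variable T : (H -> H) -> H -> H.
Local Notation X := (corner M q p).
Hypotheses (TM : forall x, X x -> M (T x))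
  (Tlin : forall (c : R[i]) x y, X x -> X y -> T (c *: x + y) = c *: T x + T y)
  (Tker : forall x u, X x -> x u = 0 -> T x u = 0).

Lemma corner_sub a : corner M q f a -> X a.
Proof.
move=> [Ma aP]; split=> // u; split; first by rewrite (aP u).1.
by rewrite -(aP u).2 -(aP (p u)).2; case: fp => _ ->.
Qed.

(** A contraction [x] in [q M f] has coefficients of modulus at most 1, since [v_i^* x = c_i f] and
    [v_i^*] is a contraction; hence [T x] is bounded by the sum of the bounds of the [T v_i]. *)
Lemma finite_basis_bounded (s : seq (H -> H)) : orthonormal_seq M f q s ->
  (forall a, corner M q f a -> corner_span s a) -> ~ unbounded_on M p q T f.
Proof.
move=> [sX so] basis bf.
pose n := size s; pose v (i : 'I_n) := nth 0 s i.
have Xv i : corner M q f (v i) by exact: sX.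
have /choice[K KP] : forall i, exists K : R, 0 <= K /\ forall u, nrm (T (v i) u) <= K * nrm u.
  by move=> i; have [K K0 KT] := op_norm_bound (Mb (TM (corner_sub (Xv i)))); exists K.
have [x [Xx xf xn [u]]] := bf (\sum_i K i) 1 ltr01.
rewrite ltNge => /negP; apply.
have Xqf : corner M q f x by case: Xx => Mx xP; split=> // w; rewrite (xP w).1 xf.
have /choice[c cP] : forall i, exists l : R[i], forall w, adjoint (v i) (x w) = l *: f w.
  by move=> i; exact: (corner_scalar hM Pf minf (Xv i) Xqf).
have c1 i : complex.Re `|c i| <= 1.
  have [w fw w0] := minimal_vector Pf f0.
  have nw : 0 < nrm w by rewrite lt_neqAle nrm_ge0 andbT eq_sym; apply/eqP => /nrm_eq0.
  rewrite -(ler_pM2r nw) -nrmZ -{1}fw -cP.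
  apply: le_trans (xn w).
  have [vM _] := Xv i; have bvi := Mb vM.
  have [_ vn] := partial_isometry_nrm bvi Pf (fun u' => ltac:(by rewrite so // eqxx scale1r)).
  exact: vn.
have xE : x = \sum_i c i *: v i.
  apply/funext => w; rewrite fct_sumE (basis _ Xqf); apply: eq_bigr => i _.
  have [Mvi vP] := Xv i.
  by change (v i (adjoint (v i) (x w)) = c i *: v i w); rewrite cP (opZ (Mb Mvi)) (vP w).2.
have TxE : T x = \sum_i c i *: T (v i).
  by rewrite {1}xE (transf_sum hM Pq Tlin) // => i; exact: corner_sub.
rewrite TxE fct_sumE mulr_suml.
apply: (big_ind2 (fun (h : H) (k : R) => nrm h <= k)) => [|h k h' k' hk hk'|i _].
- by rewrite nrm0.
- by apply: le_trans (ler_nrmD _ _) _; exact: lerD hk hk'.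
- change (nrm (c i *: T (v i) u) <= K i * nrm u); rewrite nrmZ.
  have [Ki TK] := KP i; apply: le_trans (TK u).
  by rewrite ler_piMl ?nrm_ge0.
Qed.

(** Transport of humps: if [y] is a hump on [f] and [v] is a later term of the sequence, then
    [y v^*] is a hump of the same size on the projection [v v^*]. These projections are orthogonal,
    so the gliding hump applies. *)
Lemma sequence_bounded (x : nat -> H -> H) : (forall i, corner M p f (x i)) ->
  (forall i j u, adjoint (x i) (x j u) = (i == j)%:R *: f u) -> x 0%N = f ->
  ~ unbounded_on M p q T f.
Proof.
move=> Xx xo x0 bf.
have Mx i : M (x i) by case: (Xx i).
have bx i : bounded_operator (x i) by auto.
have Max i : M (adjoint (x i)) by exact: (M_adj hM).
have af : adjoint f = f by case: Pf.
have xx i u : adjoint (x i) (x i u) = f u by rewrite xo eqxx scale1r.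
have xorth i j u : i != j -> adjoint (x i) (x j u) = 0.
  by move=> ij; rewrite xo (negbTE ij) scale0r.
have xn i := partial_isometry_nrm (bx i) Pf (xx i).
have fadj i u : f (adjoint (x i) u) = adjoint (x i) u by exact: (corner_adjoint_l hM Pf u (Xx i)).
have xf i u : x i (f u) = x i u by have [_ /(_ u)[]] := Xx i.
have px i u : p (x i u) = x i u by have [_ /(_ u)[]] := Xx i.
have adjp i u : adjoint (x i) (p u) = adjoint (x i) u.
  by apply: inner_extr => w; rewrite -!(adjointE (bx i)) -[in RHS](px i w) (projE hM Pp).
have fx i u : f (x i.+1 u) = 0 by have := xorth 0%N i.+1 u isT; rewrite x0 af.
have xsf i u : adjoint (x i.+1) (f u) = 0 by have := xorth i.+1 0%N u isT; rewrite x0.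
(* The term [x 0 = f] is skipped: the transport needs the range of [v] orthogonal to [f]. *)
pose e n := x n.+1 \o adjoint (x n.+1).
apply: (no_hump_sequence hM Pp Pq TM Tlin Tker (f := e)); last first.
  move=> i j ij u; rewrite /e /= xorth ?op0 //.
move=> n; set v := x n.+1 in e *; have bv := bx n.+1; have bav := adjoint_bounded bv.
split.
  split; last by move=> u; rewrite /e /= adjp.
  split; first by apply: (M_comp hM) => //; exact: Max.
    by rewrite /e adjoint_comp ?adjointK.
  by apply/funext => u; rewrite /e /= xx fadj.
have [y [Xy yf yn [u Tyu]]] := unbounded_hump n bf.
have [My yP] := Xy; have by_ := Mb My.
pose y' := y \o adjoint v; have y'E w : y' w = y (adjoint v w) by [].
have Xy' : X y'.
  split; first by apply: (M_comp hM) => //; exact: Max.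
  by move=> w; rewrite !y'E (yP _).1 adjp.
exists y'; split=> //.
- by move=> w; rewrite !y'E /e /= xx fadj.
- move=> w; rewrite y'E; apply: le_trans (yn _) _.
  by apply: ler_wpM2l; [rewrite exprn_ge0 ?invr_ge0|exact: (xn _).2].
have yv w : y (v w) = 0 by rewrite -yf fx op0.
(* [y'] carries [v (f u)] to [y u] and kills [f u]; [y] does the opposite. The difference thus kills
   the sum, and the kernel condition forces [T y' (v u) = T y u]. *)
have Tsum : T (y' - y) (v (f u) + f u) = 0.
  have Xd : X (y' - y) by rewrite addrC -scaleN1r; exact: corner_lin.
  apply: Tker => //; change (y' (v (f u) + f u) - y (v (f u) + f u) = 0).
  rewrite !y'E (opD bav) xx xsf addr0 (opD by_) yv add0r !yf subrr //.
exists (v u).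
have -> : T y' (v u) = T y u.
  have bT := Mb (TM Xy); have bT' := Mb (TM Xy').
  rewrite (transfB Tlin Xy' Xy) in Tsum.
  change (T y' (v (f u) + f u) - T y (v (f u) + f u) = 0) in Tsum.
  rewrite (opD bT) (opD bT') in Tsum.
  have z1 : T y' (f u) = 0 by apply: Tker => //; rewrite y'E xsf op0.
  have z2 : T y (v (f u)) = 0 by apply: Tker => //; rewrite yv.
  have z3 : T y (f u) = T y u by apply: (transf_congr hM TM Tker Xy); rewrite yf.
  move: Tsum; rewrite z1 z2 z3 (xf n.+1 u : v (f u) = v u) addr0 add0r; exact: subr0_eq.
by apply: le_lt_trans Tyu; rewrite ler_wpM2l //; exact: (xn _).1.
Qed.

(* Both alternatives for [p M f] are excluded: an infinite orthonormal sequence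
   transports the unboundedness at [f] to orthogonal projections, and a finite
   basis makes [z p M p] finite dimensional for the central support [z] of [f]. *)
Lemma minimal_bounded :
  (forall z, central_projection_in M z ->
     finite_dimensional (compression (z \o p) M p) ->
     finite_dimensional (compression (z \o q) M p)) ->
  ~ unbounded_on M p q T f.
Proof.
move=> cond bf.
(* Starting from [f] ensures [x 0 = f] in the infinite case. *)
have of_ : orthonormal_seq M f p [:: f].
  split=> [[|//] _|[|//] [|//] _ _ u] /=.
    split; first by case: Pf.
    by move=> u; rewrite (subproj_l hM u Pp fp) (proj_idem Pf).
  by rewrite scale1r; case: Pf => _ -> _; rewrite (proj_idem Pf).
have [[s [os bs]]|[x [Xx xo x0]]] := corner_basis_or_sequence hM Pf minf f0 Pp of_.
  have [z [Cz zf fd]] := finite_central_support os bs.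
  have [s' [os' bs']] := finite_corner_basis Cz zf (cond _ Cz fd).
  exact: finite_basis_bounded os' bs' bf.
by apply: (sequence_bounded Xx xo _ bf); rewrite x0.
Qed.

End Transformation.
End Corner.
End MinimalCase.

(** * From the condition on central projections to boundedness *)

Section Sufficiency.
Variables (R : realType) (H : hilbertType R) (M : set (H -> H)).
Hypothesis hM : von_neumann_algebra M.
Implicit Types (u v w : H) (A B a b c d e f g r x y z : H -> H).
Let Mb x : M x -> bounded_operator x := @M_bounded R H M hM x.
Hint Resolve Mb : core.

Lemma opnorm_ge A u : bounded_operator A -> nrm (A u) <= opnorm A * nrm u.
Proof.
move=> bA; have [C C0 AC] := op_norm_bound bA.
have [/nrm_eq0 ->|n0] := eqVneq (nrm u) 0; first by rewrite op0 // nrm0 mulr0.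
have n_gt0 : 0 < nrm u by rewrite lt_neqAle eq_sym n0 nrm_ge0.
rewrite -ler_pdivrMr // mulrC.
have -> : (nrm u)^-1 * nrm (A u) = complex.Re `|A ((nrm u)^-1%:C *: u)|.
  by rewrite -/(nrm _) (opZ bA) nrmZr ger0_norm // invr_ge0 ltW.
apply: ub_le_sup; last first.
  exists ((nrm u)^-1%:C *: u) => //=; rewrite normE -[1]/(1%:C) lecR nrmZr.
  by rewrite ger0_norm ?invr_ge0 ?(ltW n_gt0) // mulVf.
exists C => _ [w /= w1 <-]; apply: le_trans (AC w) _.
by move: w1; rewrite normE -[1]/(1%:C) lecR => w1; rewrite ler_piMr.
Qed.

Lemma opnorm_le A (C : R) : bounded_operator A -> 0 <= C ->
  (forall u, nrm (A u) <= C * nrm u) -> opnorm A <= C.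
Proof.
move=> bA C0 AC; apply: ge_sup.
  by exists (complex.Re `|A 0|), 0 => //=; rewrite normr0.
move=> _ [w /= w1 <-]; apply: le_trans (AC w) _.
by move: w1; rewrite normE -[1]/(1%:C) lecR => w1; rewrite ler_piMr.
Qed.

Variables (p q : H -> H).
Hypotheses (Pp : projection_in M p) (Pq : projection_in M q).
Variable T : (H -> H) -> H -> H.
Local Notation X := (corner M q p).
Hypotheses (TM : forall x, X x -> M (T x))
  (Tlin : forall (c : R[i]) x y, X x -> X y -> T (c *: x + y) = c *: T x + T y)
  (Tker : forall x u, X x -> x u = 0 -> T x u = 0).

(** Some [x] violates the constant [|C| / eps]; rescaled to norm [eps], its image exceeds [|C|].
    Norm 0 is excluded because [x] and [T x] would both vanish. *)
Lemma unbounded_on_of_not_bounded : ~ bounded_transformation X T -> unbounded_on M p q T p.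
Proof.
move=> /forallNP nb C eps e0.
have /existsNP[x /not_implyP[Xx /negP]] := nb (`|C| / eps); rewrite -ltNge => lt.
have bx : bounded_operator x by case: Xx => /Mb.
have bT := Mb (TM Xx).
have a0 : 0 < opnorm x.
  rewrite ltNge; apply/negP => le0.
  have x0 : x = 0.
    apply/funext => u; apply/nrm_eq0/eqP; rewrite eq_le nrm_ge0 andbT.
    by apply: le_trans (opnorm_ge u bx) _; rewrite mulr_le0_ge0 ?nrm_ge0.
  have T00 : T x = 0 by rewrite x0 (transf0 hM Pq Tlin).
  have : opnorm (T x) <= 0.
    by apply: opnorm_le => // u; rewrite T00 mul0r nrm0.
  have : 0 <= opnorm x.
    apply: ub_le_sup; last by exists 0; rewrite /= ?normr0 // op0 // normr0.
    have [K K0 xK] := op_norm_bound bx; exists K => _ [w /= w1 <-]; apply: le_trans (xK w) _.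
    by move: w1; rewrite normE -[1]/(1%:C) lecR => w1; rewrite ler_piMr.
  move=> x_ge0 T_le0; move: lt; rewrite ltNge (le_trans T_le0) //.
  by rewrite mulr_ge0 // divr_ge0 // ltW.
pose k := eps / opnorm x; have k0 : 0 < k by exact: divr_gt0.
have Xk : X (k%:C *: x) by exact: corner_scale.
exists (k%:C *: x); split=> // [u|u|].
- by change (k%:C *: x (p u) = k%:C *: x u); have [_ /(_ u)[_ ->]] := Xx.
- change (nrm (k%:C *: x u) <= eps * nrm u); rewrite nrmZr ger0_norm ?(ltW k0) //.
  rewrite /k mulrAC ler_pdivrMr // -mulrA ler_pM2l // mulrC; exact: opnorm_ge.
- apply: contrapT => /forallNP nu; move: lt; rewrite ltNge => /negP; apply.
  apply: opnorm_le => // [|u].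
    by rewrite mulr_ge0 ?(ltW a0) // divr_ge0 // ltW.
  have /negP := nu u; rewrite -leNgt (transfZ hM Pq Tlin) //.
  change (nrm (k%:C *: T x u) <= C * nrm u -> nrm (T x u) <= `|C| / eps * opnorm x * nrm u).
  rewrite nrmZr ger0_norm ?(ltW k0) // => le.
  have -> : `|C| / eps * opnorm x = `|C| / k by rewrite /k invf_div mulrA mulrAC.
  rewrite mulrAC ler_pdivlMr // mulrC; apply: le_trans le _.
  by rewrite ler_wpM2r ?nrm_ge0 // ler_norm.
Qed.

Lemma sub_neq0 f g : g <> f -> f - g <> 0.
Proof. by move=> gf /eqP; rewrite subr_eq0 => /eqP /esym. Qed.

(** If [e] splits into two unbounded pieces, either is a hump. Otherwise a nonzero piece [g] of the
    spectral projection [f] is sought on which [T] is not unbounded: then [x g] is the hump and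
    unboundedness remains on [e - g]. *)
Lemma unbounded_step n e :
  (forall f, subproj M f p -> minimal M f -> f <> 0 -> ~ unbounded_on M p q T f) ->
  subproj M e p -> unbounded_on M p q T e ->
  exists f, [/\ subproj M f e, hump M p q T n f & unbounded_on M p q T (e - f)].
Proof.
move=> min_ok ep ue; have [Pre _] := ep.
have [[f [fe uf uef]]|nsplit] := pselect (exists f,
    [/\ subproj M f e, unbounded_on M p q T f & unbounded_on M p q T (e - f)]).
  by exists f; split=> //; exact: unbounded_hump.
(* The bound [n.+1] leaves room for the strict inequality with [n], as [f] only gives a weak one. *)
have [|x [Xx xe xn [u0 xu0]]] := ue n.+1%:R (2^-1 ^+ n); first by rewrite exprn_gt0 // invr_gt0.
have [||f [fe f0 fT]] := large_projection hM (TM Xx) Pre _ _ xu0.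
- by move=> u; apply: (transf_congr hM TM Tker Xx); rewrite xe.
- by rewrite ltr0n.
have good g : subproj M g f -> g <> 0 -> ~ unbounded_on M p q T g ->
    exists f, [/\ subproj M f e, hump M p q T n f & unbounded_on M p q T (e - f)].
  move=> gf g0 ng; have ge := subproj_trans gf fe; exists g; split=> //; last first.
    by case: (unbounded_on_split hM Pp TM Tlin Tker ep ge ue).
  have gp := subproj_trans ge ep; have [Pg _] := ge.
  exists (x \o g); split.
  - exact: corner_subproj.
  - by move=> u /=; rewrite (proj_idem Pg).
  - move=> u /=; apply: le_trans (xn _) _; apply: ler_wpM2l; last exact: (proj_nrm hM Pg).
    by rewrite exprn_ge0 // invr_ge0.
  have [u gu u0'] := minimal_vector Pg g0; exists u.
  have fu : f u = u by have [Pf _] := fe; rewrite -gu (subproj_l hM _ Pf gf).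
  rewrite (transf_subproj hM Pp TM Tlin Tker) // gu; apply: lt_le_trans (fT _ fu).
  rewrite ltr_pM2r ?ltr_nat // lt_neqAle nrm_ge0 andbT eq_sym.
  by apply/eqP => /nrm_eq0.
have [Pf _] := fe.
have [uf|nf] := pselect (unbounded_on M p q T f); last first.
  by apply: (good f) => //; exact: subproj_refl.
have fp := subproj_trans fe ep.
have [|g [gf g0 gf']] := split_projection hM Pf.
  by move=> mf; apply: (min_ok f).
have [fgf gfg] := subproj_sub hM Pf gf.
have [ug|ng] := pselect (unbounded_on M p q T g); last exact: (good g).
(* [T] is not unbounded on [f - g] as well as on [g]: since [f - g] lies below [e - g], this would
   split [e] into two unbounded pieces. *)
apply: (good (f - g)) => //; first exact: sub_neq0.
move=> ufg; apply: nsplit; exists g; split=> //; first exact: subproj_trans gf fe.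
apply: unbounded_on_sub ufg.
have [Pfg _] := fgf; have ge := subproj_trans gf fe; split=> // u.
have bfg := proj_bounded hM Pfg; have [Pg _] := gf.
change ((f - g) (e u - g u) = (f - g) u).
rewrite (opB bfg).
change (f (e u) - g (e u) - (f (g u) - g (g u)) = f u - g u).
have [_ fe'] := fe; have [_ ge'] := ge.
by rewrite fe' ge' (subproj_l hM u Pf gf) (proj_idem Pg) subrr subr0.
Qed.

Theorem decomposable_bounded :
  (forall z, central_projection_in M z ->
     finite_dimensional (compression (z \o p) M p) ->
     finite_dimensional (compression (z \o q) M p)) ->
  bounded_transformation X T.
Proof.
move=> cond; apply: contrapT => /unbounded_on_of_not_bounded up.
have min_ok f : subproj M f p -> minimal M f -> f <> 0 -> ~ unbounded_on M p q T f.
  by move=> fp mf f0; exact: (minimal_bounded hM Pp Pq fp mf f0 TM Tlin Tker cond).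
have [f [fP forth]] := orthogonal_sequence hM Pp up
  (fun n e ep ue => @unbounded_step n e min_ok ep ue).
exact: (no_hump_sequence hM Pp Pq TM Tlin Tker fP forth).
Qed.

End Sufficiency.

(** * An unbounded decomposable transformation *)

Section Necessity.
Variables (R : realType) (H : hilbertType R) (M : set (H -> H)).
Hypothesis hM : von_neumann_algebra M.
Implicit Types (u v w : H) (A B a b c d e f g r x y z : H -> H).
Let Mb x : M x -> bounded_operator x := @M_bounded R H M hM x.
Hint Resolve Mb : core.
Variables (p q : H -> H).
Hypothesis Pp : projection_in M p.

Section UnboundedModuleMap.
Variable e : H -> H.
Hypotheses (ep : subproj M e p) (mine : minimal M e) (e0 : e <> 0).
Let Pre : projection_in M e. Proof. by case: ep. Qed.
Variable x : nat -> H -> H.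
Hypotheses (Xx : forall i, corner M q e (x i))
  (xo : forall i j u, adjoint (x i) (x j u) = (i == j)%:R *: e u).
Variable s : seq (H -> H).
Hypotheses (os : orthonormal_seq M e p s)
  (basis : forall a, corner M p e a -> corner_span s a).
Local Notation X := (corner M q p).

(** [F N] truncates the formal functional sending [x n] to [n]. [W] collects the [y] on which it
    eventually vanishes: it contains [x n - n x 1] but not [x 1], so a functional vanishing on [W]
    with value 1 at [x 1] takes the value [n] at [x n]. *)
Lemma sequence_functional : exists phi : (H -> H) -> R[i],
  [/\ forall (l : R[i]) y z, phi (l *: y + z) = l * phi y + phi z
    & forall n, phi (x n) = n%:R].
Proof.
have bx i : bounded_operator (x i) by case: (Xx i); auto.
have bax i : bounded_operator (adjoint (x i)) by exact: adjoint_bounded.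
pose F N y u := \sum_(n < N) n%:R *: adjoint (x n) (y u).
have Flin N (l : R[i]) y z u : F N (l *: y + z) u = l *: F N y u + F N z u.
  rewrite /F scaler_sumr -big_split /=; apply: eq_bigr => i _.
  change (i%:R *: adjoint (x i) (l *: y u + z u) =
    l *: (i%:R *: adjoint (x i) (y u)) + i%:R *: adjoint (x i) (z u)).
  by rewrite (opP (bax i)) scalerDr !scalerA mulrC.
have Fx N n u : (n < N)%N -> F N (x n) u = n%:R *: e u.
  move=> nN; rewrite /F (bigD1 (Ordinal nN)) //= xo eqxx scale1r big1 ?addr0 // => i ni.
  rewrite xo (_ : (i == n :> nat) = false) ?scale0r ?scaler0 //.
  by apply: contraNF ni => /eqP E; apply/eqP/val_inj.
pose W := [set y | exists N, forall N', (N <= N')%N -> forall u, F N' y u = 0].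
have sW : linear_subspace W.
  split=> [|l y z [N1 y0] [N2 z0]].
    by exists 0 => N' _ u; rewrite /F big1 // => i _; rewrite (op0 (bax i)) scaler0.
  exists (maxn N1 N2) => N'; rewrite geq_max => /andP[h1 h2] u.
  by rewrite Flin y0 // z0 // scaler0 addr0.
have Wn n : W (x n - n%:R *: x 1).
  exists (maxn n 1).+1 => N' h u.
  have [h1 h2] : (n < N')%N /\ (1 < N')%N.
    by split; apply: leq_trans h; rewrite ltnS ?leq_maxl ?leq_maxr.
  by rewrite addrC -scaleNr Flin !Fx // scale1r scaleNr addNr.
have nW1 : ~ W (x 1).
  move=> [N /(_ (maxn N 2) (leq_maxl _ _)) W1]; apply: e0; apply/funext => u.
  by have := W1 u; rewrite Fx ?leq_maxr // scale1r.
have [phi [philin phiW phi1]] := separating_functional sW nW1.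
exists phi; split=> // n.
rewrite -[x n](subrK (n%:R *: x 1)) addrC philin phi1 mulr1 phiW ?addr0 //.
Qed.

(* [T] is a right module map over [p M p], hence decomposable. *)
Lemma unbounded_decomposable : exists T : (H -> H) -> H -> H,
  [/\ forall y, X y -> M (T y),
      forall (l : R[i]) y z, X y -> X z -> T (l *: y + z) = l *: T y + T z,
      forall y u, X y -> y u = 0 -> T y u = 0
    & ~ bounded_transformation X T].
Proof.
have [phi [philin phix]] := sequence_functional.
have phi0 : phi 0 = 0.
  have := philin 1 0 0; rewrite scaler0 addr0 mul1r => E.
  by apply: (addIr (phi 0)); rewrite -E add0r.
have phi_sum n (l : 'I_n -> R[i]) (y : 'I_n -> H -> H) :
    phi (\sum_i l i *: y i) = \sum_i l i * phi (y i).
  apply: (big_rec2 (fun (g : H -> H) (k : R[i]) => phi g = k)) => [//|i g k _ <-].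
  exact: philin.
have [sX so] := os.
pose n := size s; pose v (i : 'I_n) := nth 0 s i.
have bs i : (i < size s)%N -> bounded_operator (nth 0 s i) by move=> /sX[/Mb].
have Xv i : corner M p e (v i) by exact: sX.
have vo i j u : adjoint (v i) (v j u) = (i == j)%:R *: e u by exact: so.
have Mv i : M (v i) by case: (Xv i).
have bv i : bounded_operator (v i) by auto.
have eav i u : e (adjoint (v i) u) = adjoint (v i) u by exact: (corner_adjoint_l hM Pre u (Xv i)).
pose T y := \sum_i phi (y \o v i) *: adjoint (v i).
have TE y u : T y u = \sum_i phi (y \o v i) *: adjoint (v i) u by rewrite /T fct_sumE.
have MT y : M (T y).
  by apply: (M_sum hM) => i _; apply: (M_scale hM); apply: (M_adj hM).
exists T; split=> [y _ //|l y z _ _|y u Xy yu|[C TC]].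
- rewrite /T scaler_sumr -big_split /=; apply: eq_bigr => i _.
  by rewrite scalerA -scalerDl -philin.
- have [My yP] := Xy; have by_ := Mb My.
  have [|g [Pg g0 _]] := @kernel_support _ _ _ hM [set y]; first by move=> _ ->.
  have yg w : y (g w) = y w.
    apply/eqP; rewrite -subr_eq0 -(opB by_); apply/eqP.
    by apply: (g0 _).1 => //; rewrite (opB (proj_bounded hM Pg)) (proj_idem Pg) subrr.
  (* Here [y a = y] while [a u = 0], so the module property at [a] yields
     [T y u = T y (a u) = 0]. *)
  pose a := p \o g \o p.
  have Ma : M a.
    by apply: (M_comp hM); [apply: (M_comp hM)|];
      [exact: proj_M Pp|exact: proj_M Pg|exact: proj_M Pp].
  have ba := Mb Ma.
  have asym w h : inner H (a w) h = inner H w (a h).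
    by rewrite /a /= (projE hM Pp) (projE hM Pg) (projE hM Pp).
  have ya : y \o a = y.
    by apply/funext => w; rewrite /a /= (yP _).2 yg (yP _).2.
  have au : a u = 0.
    rewrite /a /= (_ : g (p u) = 0) ?(op0 (proj_bounded hM Pp)) //.
    by apply/g0 => _ ->; rewrite (yP _).2.
  suff Tya w : T (y \o a) w = T y (a w) by rewrite -ya Tya au op0 //; exact: Mb.
  have Xav j : corner M p e (a \o v j).
    split; first exact: (M_comp hM).
    by move=> h; rewrite /a /= (proj_idem Pp) ((Xv j).2 h).2.
  have /choice[l lP] : forall ij : 'I_n * 'I_n, exists l : R[i], forall h,
      adjoint (v ij.1) (a (v ij.2 h)) = l *: e h.
    by move=> [i j]; exact: (corner_scalar hM Pre mine (Xv i) (Xav j)).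
  have avE j : y \o a \o v j = \sum_i l (i, j) *: (y \o v i).
    apply/funext => h; rewrite fct_sumE /=.
    rewrite [X in y X](basis (Xav j) h) (op_sum by_); apply: eq_bigr => i _.
    rewrite -/(v i) /= (lP (i, j)) (opZ (bv i)) (opZ by_).
    by change (l (i, j) *: y (v i (e h)) = l (i, j) *: y (v i h)); rewrite ((Xv i).2 h).2.
  (* The matrix [l] of left multiplication by [a] on the basis [v] moves to the other factor: the
     sum over [j] of [l (i, j) v_j^*] is [v_i^* a]. *)
  rewrite !TE.
  transitivity (\sum_j \sum_i (l (i, j) * phi (y \o v i)) *: adjoint (v j) w).
    by apply: eq_bigr => j _; rewrite avE phi_sum scaler_suml.
  rewrite exchange_big /=; apply: eq_bigr => i _.
  under eq_bigr do rewrite mulrC -scalerA.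
  rewrite -scaler_sumr; congr (_ *: _).
  have bai := adjoint_bounded (bv i).
  transitivity (adjoint (v i) (a (\sum_j v j (adjoint (v j) w)))).
    rewrite (op_sum ba) (op_sum bai); apply: eq_bigr => j _.
    by rewrite (lP (i, j)) eav.
  apply: inner_extl => h; rewrite -!(adjointEr (bv i)) !asym (frame_symmetric _ _ bs).
  by rewrite -(basis (Xav i) h).
have [h eh h0] := minimal_vector Pre e0.
have nh : 0 < nrm h by rewrite lt_neqAle nrm_ge0 andbT eq_sym; apply/eqP => /nrm_eq0.
have Xe : corner M p e e.
  split; first exact: proj_M Pre.
  by move=> u; rewrite (subproj_l hM u Pp ep) (proj_idem Pre).
have n0 : (0 < n)%N.
  rewrite lt0n; apply/eqP => n0; apply: h0; rewrite -eh (basis Xe h).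
  by apply: big1 => -[i ilt]; exfalso; move: ilt; rewrite -/n n0.
pose i0 := Ordinal n0; have bv0 := bv i0; have bav0 := adjoint_bounded bv0.
have bx i : bounded_operator (x i) by case: (Xx i); auto.
have [vn avn] := partial_isometry_nrm hM bv0 Pre (fun u => ltac:(by rewrite vo eqxx scale1r)).
pose m := (Num.truncn `|C|).+1; have Cm : `|C| < m%:R by exact: truncnS_gt.
have [xn _] := partial_isometry_nrm hM (bx m) Pre (fun u => ltac:(by rewrite xo eqxx scale1r)).
(* A contraction with [T y = m v^*] for [v = v i0], where [m] exceeds [|C|]. *)
pose y := x m \o adjoint (v i0).
have [Mxm xmP] := Xx m.
have adjp u : adjoint (v i0) (p u) = adjoint (v i0) u.
  apply: inner_extr => w.
  by rewrite -!(adjointE bv0) -[in RHS]((Xv i0).2 w).1 (projE hM Pp).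
have Xy : X y.
  split; first by apply: (M_comp hM) => //; exact: (M_adj hM).
  by move=> u; rewrite /y /= (xmP _).1 adjp.
have yv i : y \o v i = if i == i0 then x m else 0.
  apply/funext => u; rewrite /y /= vo eq_sym; case: eqP => _.
    by rewrite scale1r (xmP u).2.
  by rewrite scale0r op0.
have TyE u : T y u = m%:R *: adjoint (v i0) u.
  rewrite TE (bigD1 i0) //= yv eqxx phix big1 ?addr0 // => i ii.
  by rewrite yv (negbTE ii) phi0 scale0r.
have y1 : opnorm y <= 1.
  apply: opnorm_le => [|//|u]; first by case: Xy; auto.
  by rewrite mul1r; apply: le_trans (xn _) (avn u).
have y_ge0 : 0 <= opnorm y.
  have := opnorm_ge (v i0 h) (bounded_comp (bx m) bav0).
  rewrite -/y; apply: contraTT; rewrite -!ltNge => lt0.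
  have v0 : 0 < nrm (v i0 h).
    rewrite lt_neqAle nrm_ge0 andbT eq_sym; apply/eqP => /nrm_eq0 E; apply: h0.
    by rewrite -eh -[e h]scale1r -[1]/(true%:R) -(eqxx i0) -vo E op0.
  by apply: lt_le_trans (nrm_ge0 _); rewrite nmulr_rlt0.
have := opnorm_ge (v i0 h) (Mb (MT y)).
rewrite TyE vo eqxx scale1r eh -(rmorph_nat (real_complex R)) nrmZr ger0_norm //.
rewrite leNgt => /negP; apply.
apply: (@le_lt_trans _ _ (`|C| * nrm h)); last by rewrite ltr_pM2r.
apply: (@le_trans _ _ (`|C| * nrm (v i0 h))); last by rewrite ler_wpM2l.
apply: ler_wpM2r; first exact: nrm_ge0.
apply: le_trans (TC _ Xy) _; apply: (@le_trans _ _ (`|C| * opnorm y)).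
  by rewrite ler_wpM2r // ler_norm.
by rewrite ler_piMr.
Qed.

End UnboundedModuleMap.

End Necessity.

(** * From boundedness to the condition on central projections *)

Section FiniteCorner.
Variables (R : realType) (H : hilbertType R) (M : set (H -> H)).
Hypothesis hM : von_neumann_algebra M.
Implicit Types (u v w : H) (A B a b c d e f g r x y z : H -> H).
Let Mb x : M x -> bounded_operator x := @M_bounded R H M hM x.
Hint Resolve Mb : core.
Variables (p q : H -> H).
Hypotheses (Pp : projection_in M p) (Pq : projection_in M q).

(** Moving [z] to the right turns [z q M p] into [q M (z p)], which can be studied by splitting
    [z p]. *)
Lemma corner_central z : central_projection_in M z ->
  compression (z \o q) M p = corner M q (z \o p).
Proof.
move=> Cz; have [Pz zc] := Cz; have Pzq := central_comp hM Cz Pq.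
rewrite compression_corner //; apply/seteqP; split=> x [Mx xP]; split=> // u.
  have zxE w : z (x w) = x w by rewrite -(xP w).1 /= (proj_idem Pz).
  have := congr1 (@^~ (p u)) (zc _ Mx) => /= <-.
  rewrite (xP u).2 zxE; split=> //.
  rewrite -[in LHS](xP u).1 -[in RHS](xP u).1 /=.
  by have /= -> := congr1 (@^~ (x u)) (zc _ (proj_M Pq)); rewrite (proj_idem Pq).
have zxE w : z (x w) = x w.
  rewrite -[in LHS](xP w).2 /=; have /= -> := congr1 (@^~ (z (p w))) (zc _ Mx).
  by rewrite (proj_idem Pz) -[RHS](xP w).2.
split; first by rewrite /= (xP u).1 zxE.
by rewrite -[LHS](xP _).2 -[RHS](xP u).2 /= (proj_idem Pp).
Qed.

Lemma corner_basis_finite_dimensional e (s : seq (H -> H)) : projection_in M e -> minimal M e ->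
  orthonormal_seq M e q s -> (forall a, corner M q e a -> corner_span s a) ->
  finite_dimensional (corner M q e).
Proof.
move=> Pre mine [sX so] basis; exists (size s), (fun i => nth 0 s i); split=> [i|x Xx].
  exact: sX.
have Xv (i : 'I_(size s)) : corner M q e (nth 0 s i) by exact: sX.
have /choice[l lP] : forall i : 'I_(size s), exists l : R[i], forall u,
    adjoint (nth 0 s i) (x u) = l *: e u.
  by move=> i; exact: (corner_scalar hM Pre mine (Xv i) Xx).
exists l; apply/funext => u; rewrite fct_sumE (basis _ Xx); apply: eq_bigr => i _.
have [Mi iP] := Xv i; rewrite lP (opZ (Mb Mi)) (iP u).2 //.
Qed.

Lemma corner_mono e g x : subproj M g e -> corner M q g x -> corner M q e x.
Proof.
move=> [_ ge] [Mx xP]; split=> // u; split; first by rewrite (xP u).1.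
by rewrite -(xP (e u)).2 ge (xP u).2.
Qed.

Lemma corner_split_finite_dimensional e f : projection_in M e -> subproj M f e ->
  finite_dimensional (corner M q f) -> finite_dimensional (corner M q (e - f)) ->
  finite_dimensional (corner M q e).
Proof.
move=> Pre fe [n1 [b1 [b1X b1P]]] [n2 [b2 [b2X b2P]]].
have [Pf _] := fe; have [efe _] := subproj_sub hM Pre fe; have [Pef _] := efe.
have comp g x : subproj M g e -> corner M q e x -> corner M q g (x \o g).
  move=> [Pg ge] [Mx xP]; split; first by apply: (M_comp hM) => //; exact: proj_M Pg.
  by move=> u /=; rewrite (xP _).1 (proj_idem Pg).
pose b (i : 'I_n1 + 'I_n2) := match i with inl i => b1 i | inr i => b2 i end.
apply: (@finite_dimensional_fin _ _ _ _ b) => [[i|i]|x Xx].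
- exact: corner_mono fe (b1X i).
- exact: corner_mono efe (b2X i).
have [c1 E1] := b1P _ (comp _ _ fe Xx); have [c2 E2] := b2P _ (comp _ _ efe Xx).
exists (fun i => match i with inl i => c1 i | inr i => c2 i end).
rewrite big_sumType /= -E1 -E2; have [Mx xP] := Xx.
apply/funext => u; change (x u = x (f u) + x (e u - f u)).
by rewrite (opB (Mb Mx)) (xP u).2 addrC subrK.
Qed.

End FiniteCorner.

Section FiniteCentral.
Variables (R : realType) (H : hilbertType R) (M : set (H -> H)).
Hypothesis hM : von_neumann_algebra M.
Implicit Types (e f x z : H -> H).
Variables (p q : H -> H).
Hypotheses (Pp : projection_in M p) (Pq : projection_in M q).
Hypothesis all_bounded : forall T : (H -> H) -> H -> H,
  linear_transformation (corner M q p) M T -> decomposable (corner M q p) M T ->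
  bounded_transformation (corner M q p) T.
Variable z : H -> H.
Hypotheses (Cz : central_projection_in M z)
  (fd : finite_dimensional (compression (z \o p) M p)).
Let Pz : projection_in M z. Proof. by case: Cz. Qed.
Let Pzp : projection_in M (z \o p). Proof. exact: central_comp. Qed.

(** Given an infinite orthonormal sequence in [q M e], a finite basis of [p M e] would allow an
    unbounded decomposable map, and an infinite sequence in [p M e] would be independent in
    [z p M p]. *)
Lemma minimal_corner_finite_dimensional e : subproj M e (z \o p) -> minimal M e ->
  e <> 0 -> finite_dimensional (corner M q e).
Proof.
move=> ezp mine e0; have [Pre _] := ezp.
have zpp : subproj M (z \o p) p by split=> // u /=; rewrite (proj_idem Pp).
have ep := subproj_trans ezp zpp.
have nil_ortho r : orthonormal_seq M e r [::] by split.
have [[s [os bs]]|[x [Xx xo _]]] := corner_basis_or_sequence hM Pre mine e0 Pq (nil_ortho q).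
  exact: corner_basis_finite_dimensional os bs.
exfalso.
have [[s [os bs]]|[y [Xy yo _]]] := corner_basis_or_sequence hM Pre mine e0 Pp (nil_ortho p).
  have [T [TM Tlin Tker]] := unbounded_decomposable hM Pp ep mine e0 Xx xo os bs.
  apply; apply: all_bounded; first by split.
  by apply/(decomposable_kernel hM _ TM) => // ? [].
have := fd; rewrite (corner_central hM Pp Pp Cz).
apply: (@not_finite_dimensional _ _ _ y (fun i => adjoint (y i))) => [i|i|i j ij|i E].
- exact: corner_mono ezp (Xy i).
- by apply: adjoint_bounded; apply: (M_bounded hM); case: (Xy i).
- by apply/funext => u /=; rewrite yo (negbTE ij) scale0r.
- apply: e0; apply/funext => u.
  by have /= := congr1 (@^~ u) E; rewrite yo eqxx scale1r.
Qed.

(* Otherwise splitting off projections would give infinitely many orthogonal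
   nonzero projections in the finite dimensional algebra [z p M p]. *)
Lemma corner_finite_dimensional : finite_dimensional (corner M q (z \o p)).
Proof.
apply: contrapT => nfd.
have [|f [fP forth]] := orthogonal_sequence hM (P := fun e => ~ finite_dimensional (corner M q e))
  (Q := fun _ f => f <> 0) Pzp nfd.
  move=> _ e ezp nfde; have [Pre _] := ezp.
  have e0 : e <> 0.
    move=> e0; apply: nfde; exists 0%N, (fun _ => 0); split=> [[]//|x [Mx xP]].
    exists (fun _ => 0); rewrite big_ord0; apply/funext => u.
    by rewrite -(xP u).2 e0 (op0 (M_bounded hM Mx)).
  have [|f [fe f0 fe0]] := split_projection hM Pre.
    by move=> mine; apply: nfde; exact: minimal_corner_finite_dimensional.
  have [efe _] := subproj_sub hM Pre fe.
  have [fdef|] := pselect (finite_dimensional (corner M q (e - f))); last by exists f.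
  (* The roles are exchanged: [e - f] is split off and [f] kept, since [q M f] must then be infinite
     dimensional. *)
  exists (e - f); split=> //; first exact: sub_neq0.
  rewrite opprB addrC subrK => fdf.
  by apply: nfde; exact: corner_split_finite_dimensional fe fdf fdef.
have zpp : subproj M (z \o p) p by split=> // u /=; rewrite (proj_idem Pp).
have Pf i : projection_in M (f i) by case: (fP i) => -[].
have := fd; rewrite (corner_central hM Pp Pp Cz).
apply: (@not_finite_dimensional _ _ _ f f) => [i|i|i j ij|i].
- have [fzp _] := fP i; split; first exact: proj_M.
  by move=> u; rewrite (subproj_l hM u Pp (subproj_trans fzp zpp)); case: fzp => _ ->.
- exact: (proj_bounded hM (Pf i)).
- by apply/funext => u /=; rewrite forth.
- have [_ fi0] := fP i; have [_ _ ->] := Pf i; exact: fi0.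
Qed.

End FiniteCentral.

Theorem theorem2p1 (R : realType) (H : hilbertType R) (M : set (H -> H))
    (p q : H -> H) (hM : von_neumann_algebra M)
    (hp : projection_in M p) (hq : projection_in M q) :
  (forall T : (H -> H) -> H -> H,
     linear_transformation (compression q M p) M T ->
     decomposable (compression q M p) M T ->
     bounded_transformation (compression q M p) T)
  <->
  (forall z : H -> H, central_projection_in M z ->
     finite_dimensional (compression (z \o p) M p) ->
     finite_dimensional (compression (z \o q) M p)).
Proof.
rewrite (compression_corner hM hq hp); split=> [all_bounded z Cz fd|cond T [TM Tlin] dT].
  by rewrite (corner_central hM hp hq Cz); exact: corner_finite_dimensional fd.
apply: (decomposable_bounded hM hp hq TM Tlin _ cond).
by apply/(decomposable_kernel hM _ TM) => // x [].
Qed.
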